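(* Let $\{f_t:t\in\mathbb{N}\}$ be a countably infinite set of scaling functions totally ordered by domination. For each $t\in\mathbb{N}$ let $\Xi_t$ and $\Xi'_t$ be any scale limits. Let $\Gamma$ be any permuton, and let $\Lambda$ and $\Lambda'$ be any permutation local limits. Then there exists a sequence of permutations $(\tau_j)_{j\in\mathbb{N}}$ with $|\tau_j|\to\infty$ which converges to $\Xi_t$ at scale $f_t$ for every $t$, converges globally to $\Gamma$, and converges locally to $\Lambda$, and such that the sequence of inverses $(\tau_j^{-1})_{j\in\mathbb{N}}$ converges to $\Xi'_t$ at scale $f_t$ for every $t$ and converges locally to $\Lambda'$.
   Context: For $g,h:\mathbb{N}\to\mathbb{R}^+$ write $g\ll h$ if $g(n)/h(n)\to0$. A scaling function is a function $f:\mathbb{N}\to\mathbb{R}^+$ with $f(n)\le n$ for all $n$, $f(n)\to\infty$ and $f(n)/n\to 0$. A set of scaling functions is totally ordered by domination if for every two distinct members $f,g$ either $f\ll g$ or $g\ll f$. Let $S_n$ be the set of permutations of $[n]$ and $S=\bigcup_nS_n$. An occurrence of $\pi\in S_k$ in $\sigma\in S_n$ is a set of indices $i_1<\dots<i_k$ with $\sigma(i_1)\dots\sigma(i_k)$ order-isomorphic to $\pi$; its width is $i_k-i_1+1$. For real $f\in[k,n]$, $\rho_f(\pi,\sigma)$ is the number of occurrences of $\pi$ in $\sigma$ of width at most $f$ divided by the number of $k$-subsets of $[n]$ of width at most $f$; the global density is $\rho(\pi,\sigma)=\rho_n(\pi,\sigma)$ and the local density is $\rho_k(\pi,\sigma)$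 (consecutive occurrences). A sequence $(\sigma_j)$ with $|\sigma_j|\to\infty$ converges at scale $f$ to $\Xi\in[0,1]^S$ if $\rho_{f(|\sigma_j|)}(\pi,\sigma_j)\to\Xi_\pi$ for all $\pi\in S$; a scale limit is a $\Xi$ arising in this way for some scaling function and some sequence. The sequence converges locally to $\Lambda\in[0,1]^S$ if $\rho_{|\pi|}(\pi,\sigma_j)\to\Lambda_\pi$ for all $\pi$; a permutation local limit is a $\Lambda$ arising in this way. A permuton is a Borel probability measure $\Gamma$ on $[0,1]^2$ with uniform marginals; $\rho(\pi,\Gamma)$ is the probability that $k=|\pi|$ independent $\Gamma$-distributed points, listed in increasing order of $x$-coordinate, have $y$-coordinates order-isomorphic to $\pi$. The sequence converges globally to $\Gamma$ if $\rho(\pi,\sigma_j)\to\rho(\pi,\Gamma)$ for all $\pi$. $\tau^{-1}$ denotes the inverse permutation. *)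

(* Defs.v *)
From HB Require Import structures.
From mathcomp Require Import all_boot all_order all_algebra all_fingroup.
From mathcomp Require Import all_classical all_reals all_analysis.
Set Implicit Arguments. Unset Strict Implicit. Unset Printing Implicit Defensive.
Import Order.TTheory GRing.Theory Num.Theory.
Import numFieldNormedType.Exports.
Local Open Scope classical_set_scope.
Local Open Scope ring_scope.

Definition AnyPerm := {n : nat & 'S_n}.
Definition psize (s : AnyPerm) : nat := projT1 s.
Definition anyperm_inv (s : AnyPerm) : AnyPerm := existT _ (projT1 s) (projT2 s)^-1%g.

(* increasing maps 'I_k -> 'I_n = k-subsets of [n] *)
Definition incr k n (g : {ffun 'I_k -> 'I_n}) : bool :=
  [forall a : 'I_k, forall b : 'I_k, (a < b)%N ==> (g a < g b)%N].

(* width i_k - i_1 + 1 (equal to 1 for the empty subset) *)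
Definition width k n (g : {ffun 'I_k -> 'I_n}) : nat :=
  (\max_(a : 'I_k) \max_(b : 'I_k) (g b - g a)%N).+1.

Definition occ k n (pi : 'S_k) (sigma : 'S_n) (g : {ffun 'I_k -> 'I_n}) : bool :=
  [forall a : 'I_k, forall b : 'I_k,
     ((sigma (g a) < sigma (g b))%N == (pi a < pi b)%N)].

Definition rho {R : realType} (f : R) k n (pi : 'S_k) (sigma : 'S_n) : R :=
  (#|[set g : {ffun 'I_k -> 'I_n} | incr g && ((width g)%:R <= f) && occ pi sigma g]|)%:R
  / (#|[set g : {ffun 'I_k -> 'I_n} | incr g && ((width g)%:R <= f)]|)%:R.

Definition rhoP {R : realType} (f : R) (pi : AnyPerm) (sigma : AnyPerm) : R :=
  rho f (projT2 pi) (projT2 sigma).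

Definition dom_ll {R : realType} (g h : nat -> R) : Prop :=
  (fun n => g n / h n) @ \oo --> (0 : R).

(* functions N -> R^+, N = {1,2,...} *)
Definition scaling_function {R : realType} (f : nat -> R) : Prop :=
  (forall n, (0 < n)%N -> 0 < f n /\ f n <= n%:R) /\
  (forall M : R, exists N, forall n, (N <= n)%N -> M < f n) /\
  dom_ll f (fun n => n%:R).

Definition size_to_infty (s : nat -> AnyPerm) : Prop :=
  forall M, exists J, forall j, (J <= j)%N -> (M <= psize (s j))%N.

Definition conv_at_scale {R : realType} (f : nat -> R) (s : nat -> AnyPerm)
    (Xi : AnyPerm -> R) : Prop :=
  forall pi : AnyPerm,
    (fun j => rhoP (f (psize (s j))) pi (s j)) @ \oo --> Xi pi.

Definition scale_limit {R : realType} (Xi : AnyPerm -> R) : Prop :=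
  exists (f : nat -> R) (s : nat -> AnyPerm),
    scaling_function f /\ size_to_infty s /\ conv_at_scale f s Xi.

Definition conv_locally {R : realType} (s : nat -> AnyPerm) (L : AnyPerm -> R) : Prop :=
  forall pi : AnyPerm,
    (fun j => rhoP ((psize pi)%:R) pi (s j)) @ \oo --> L pi.

Definition local_limit {R : realType} (L : AnyPerm -> R) : Prop :=
  exists s : nat -> AnyPerm, size_to_infty s /\ conv_locally s L.

(* Permutons: probability measures on R^2 (Borel = product sigma-algebra)
   whose two marginals are the uniform (Lebesgue) measure on [0,1];
   such a measure is concentrated on [0,1]^2. *)
Definition permuton {R : realType}
    (G : probability (measurableTypeR R * measurableTypeR R)%type R) : Prop :=
  forall A : set R, measurable A ->
    G (fst @^-1` A) = lebesgue_measure (A `&` `[0, 1]) /\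
    G (snd @^-1` A) = lebesgue_measure (A `&` `[0, 1]).

(* indicator that the points of s, listed by increasing x-coordinate,
   have y-coordinates order-isomorphic to pi (ties have probability 0 and
   are counted as failures) *)
Definition pattern_ind {R : realType} k (pi : 'S_k) (s : seq (R * R)) : \bar R :=
  (([exists perm_s : 'S_k,
     [forall a : 'I_k, forall b : 'I_k,
       ((a < b)%N ==> ((nth (0,0) s (perm_s a)).1 < (nth (0,0) s (perm_s b)).1))
       && (((nth (0,0) s (perm_s a)).2 < (nth (0,0) s (perm_s b)).2) == (pi a < pi b)%N)]]
   : bool)%:R)%:E.

Fixpoint iter_int {R : realType}
    (G : probability (measurableTypeR R * measurableTypeR R)%type R)
    (k : nat) (h : seq (R * R) -> \bar R) : \bar R :=
  match k with
  | 0 => h [::]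
  | k'.+1 => (\int[G]_p iter_int G k' (fun s => h (p :: s)))%E
  end.

Definition rho_permuton {R : realType}
    (G : probability (measurableTypeR R * measurableTypeR R)%type R) (pi : AnyPerm) : R :=
  fine (iter_int G (projT1 pi) (pattern_ind (projT2 pi))).

Definition conv_globally {R : realType} (s : nat -> AnyPerm)
    (G : probability (measurableTypeR R * measurableTypeR R)%type R) : Prop :=
  forall pi : AnyPerm,
    (fun j => rhoP ((psize (s j))%:R) pi (s j)) @ \oo --> rho_permuton G pi.

(* Main.v *)
(** Cut the positions into blocks.  If, inside consecutive frames of [s] blocks
    of length [b], the permutation [tau] compares points of distinct blocks as a
    fixed [sigma] in [S_s] compares the block indices, then the windows of width
    at most [b * w] of [tau] that stay inside a frame and meet distinct blocks
    are exactly the lifts of the windows of width at most [w] of [sigma].  If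
    almost all windows are of this kind, the two pattern densities are close.

    Positions and values are decoupled by the permutation
    [(u, v) |-> (A v, B u)] of a grid ordered lexicographically: short windows
    of positions only see [A], short windows of values only see [B].  Inflating
    such permutations into each other, one layer per scale and with block length
    about [f t n / (w * w')] in the layer of [f t], realises finitely many scales
    at once, since [f t] is negligible against the next scale as [n] grows; the
    innermost layer realises the local limits, and the outermost one is a
    permutation approximating the permuton.  The latter is read off from the
    masses of the cells of a fine grid: points in distinct rows and columns of
    the grid have a pattern determined by their cells.  A diagonal argument over
    the number of scales, the size of the patterns and the precision
    concludes. *)

Require Import Defs.
From HB Require Import structures.
From mathcomp Require Import all_boot all_order all_algebra all_fingroup.
From mathcomp Require Import all_classical all_reals all_analysis.
From mathcomp Require Import measurable_realfun zify ring lra.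

Set Implicit Arguments. Unset Strict Implicit. Unset Printing Implicit Defensive.
Import Order.TTheory GRing.Theory Num.Theory.
Import numFieldNormedType.Exports.

(** * Block structure, inflation and decoupling *)

(** Extended by the identity outside the domain, so that digit arithmetic on positions takes place
    in [nat] rather than in ordinal types. *)
Definition pnat n (s : 'S_n) (x : nat) : nat :=
  if insub x is Some i then nat_of_ord (s i) else x.

Lemma pnatE n (s : 'S_n) (i : 'I_n) : pnat s i = s i.
Proof. by rewrite /pnat valK. Qed.

Lemma pnat_lt n (s : 'S_n) x : x < n -> pnat s x < n.
Proof. by move=> xn; rewrite -[x]/(nat_of_ord (Ordinal xn)) pnatE. Qed.

Lemma pnatK n (s : 'S_n) x : x < n -> pnat s^-1%g (pnat s x) = x.
Proof.
by move=> xn; rewrite -[x]/(nat_of_ord (Ordinal xn)) !pnatE permK.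
Qed.

(** An injection of a finite set into itself is onto, which forces a left inverse to be the inverse
    permutation. Both directions are exported because every construction below is read on positions
    and on values. *)
Lemma nat_perm n (f g : nat -> nat) :
    (forall x, x < n -> f x < n) -> (forall x, x < n -> g (f x) = x) ->
  exists s : 'S_n, (forall x, x < n -> pnat s x = f x) /\
                   (forall x, x < n -> pnat s^-1%g x = g x).
Proof.
move=> fn fK; pose h (i : 'I_n) := Ordinal (fn i (ltn_ord i)).
have hinj : injective h.
  move=> i j /(congr1 val) /= e; apply/val_inj.
  by rewrite /= -(fK i (ltn_ord i)) e fK.
have hE (i : 'I_n) : nat_of_ord (perm hinj i) = f i by rewrite permE.
exists (perm hinj); split=> x xn; rewrite -[x]/(nat_of_ord (Ordinal xn)) pnatE.
  by rewrite hE.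
move: (Ordinal xn) => {x xn} y.
by rewrite -{2}(permKV (perm hinj) y) hE fK.
Qed.

Lemma divn_digit B h l : l < B -> (h * B + l) %/ B = h.
Proof. by move=> lB; rewrite divnMDl ?divn_small ?addn0 //; apply: leq_ltn_trans lB. Qed.

Lemma modn_digit B h l : l < B -> (h * B + l) %% B = l.
Proof. by move=> lB; rewrite modnMDl modn_small. Qed.

Lemma digit_lt B m h l : h < m -> l < B -> h * B + l < m * B.
Proof. by move=> hm lB; nia. Qed.

Lemma ltn_digit B h h' l l' : l < B -> l' < B -> h != h' ->
  (h * B + l < h' * B + l') = (h < h').
Proof. move=> lB lB' hh'; nia. Qed.

(* In each of the consecutive frames of length [b * s] below [Q], the values of
   [tau] compare like those of [sigma] inflated by blocks of length [b], for
   positions in distinct blocks. *)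
Definition blockwise (Q b s n : nat) (sigma : 'S_s) (tau : 'S_n) : Prop :=
  forall x y, x < Q -> y < Q -> x %/ (b * s) = y %/ (b * s) ->
    (x %/ b) %% s != (y %/ b) %% s ->
    (pnat tau x < pnat tau y) =
    (pnat sigma ((x %/ b) %% s) < pnat sigma ((y %/ b) %% s)).

(** As [b * s] divides [r], each frame of length [c * r] splits into whole frames of length
    [c * b * s]. Two points in one of the latter share a frame for [rho], and their [c]-blocks share
    a frame for [sigma], so the two comparisons compose. *)
Lemma blockwise_trans Q c b s r n (sigma : 'S_s) (rho : 'S_r) (tau : 'S_n) :
    0 < s -> 0 < b -> 0 < r -> b * s %| r ->
  blockwise Q c rho tau -> blockwise r b sigma rho ->
  blockwise Q (c * b) sigma tau.
Proof.
move=> s0 b0 r0 /dvdnP[m rE] rt sr x y xQ yQ.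
rewrite -mulnA !divnMA => exy dxy.
set X := (x %/ c) %% r; set Y := (y %/ c) %% r.
have m0 : 0 < m by move: r0; rewrite rE; case: (m).
have XE z : ((z %/ c) %% r) %/ b %% s = z %/ c %/ b %% s.
  by rewrite rE [b * s]mulnC mulnA -modn_divl modn_dvdm ?dvdn_mull.
have X2 z : ((z %/ c) %% r) %/ (b * s) = (z %/ c %/ b %/ s) %% m.
  by rewrite rE -modn_divl divnMA.
have XY : X %/ (b * s) = Y %/ (b * s) by rewrite /X /Y !X2 exy.
have dXY : X %/ b %% s != Y %/ b %% s by rewrite /X /Y !XE.
rewrite (rt x y) //.
- by rewrite (sr X Y) ?ltn_mod // /X /Y !XE.
- by rewrite !divnMA rE mulnC !divnMA exy.
- by apply: contraNneq dXY; rewrite /X /Y => ->.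
Qed.

(** For [B = M * r], a position with digits [(h, j, i)] of ranges [m], [r], [M] goes to
    [(q h, j, t i)]: [q] permutes blocks of length [B], each made of [r] consecutive copies of [t]
    in increasing order. The inverse has the same shape. *)
Definition inflate_fun m M B (q : 'S_m) (t : 'S_M) (x : nat) : nat :=
  if x < m * B then
    pnat q (x %/ B) * B + ((x %% B) %/ M * M + pnat t (x %% M))
  else x.

Section Inflate.
Variables (m M r : nat).
Hypotheses (M0 : 0 < M) (r0 : 0 < r).
Let B := M * r.

Let low (t : 'S_M) x : (x %% B) %/ M * M + pnat t (x %% M) < B.
Proof.
have B0 : 0 < B by rewrite muln_gt0 M0.
rewrite [ltnRHS]mulnC digit_lt ?pnat_lt ?ltn_mod //.
by rewrite ltn_divLR // mulnC ltn_mod.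
Qed.

Let qlt (q : 'S_m) x : x < m * B -> pnat q (x %/ B) < m.
Proof. by move=> xm; rewrite pnat_lt // ltn_divLR // muln_gt0 M0. Qed.

Lemma inflate_fun_lt (q : 'S_m) (t : 'S_M) x : x < m * B ->
  inflate_fun B q t x < m * B.
Proof. by move=> xm; rewrite /inflate_fun xm digit_lt ?qlt. Qed.

Lemma inflate_funK (q : 'S_m) (t : 'S_M) x :
  inflate_fun B q^-1%g t^-1%g (inflate_fun B q t x) = x.
Proof.
have B0 : 0 < B by rewrite muln_gt0 M0.
have [xm|xm] := boolP (x < m * B); last by rewrite /inflate_fun (negbTE xm) (negbTE xm).
rewrite {1}/inflate_fun inflate_fun_lt // /inflate_fun xm.
rewrite divn_digit // modn_digit // divn_digit ?pnat_lt ?ltn_mod //.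
rewrite pnatK ?ltn_divLR //.
have -> : (pnat q (x %/ B) * B + (x %% B %/ M * M + pnat t (x %% M))) %% M
        = pnat t (x %% M).
  by rewrite /B mulnA mulnAC modnMDl modn_digit ?pnat_lt ?ltn_mod.
rewrite pnatK ?ltn_mod //.
have -> : x %% M = (x %% B) %% M by rewrite modn_dvdm // dvdn_mulr.
by rewrite -!divn_eq.
Qed.

Lemma blockwise_inflate_outer n (q : 'S_m) (t : 'S_M) (tau : 'S_n) :
    m * B <= n -> (forall x, x < n -> pnat tau x = inflate_fun B q t x) ->
  blockwise (m * B) B q tau.
Proof.
move=> mn tauE x y xm ym _.
have B0 : 0 < B by rewrite muln_gt0 M0.
rewrite !modn_small ?ltn_divLR // => dxy.
rewrite !tauE ?(leq_trans _ mn) // /inflate_fun xm ym ltn_digit //.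
by apply: contraNneq dxy => /(congr1 (pnat q^-1%g)); rewrite !pnatK ?ltn_divLR // => ->.
Qed.

Lemma blockwise_inflate_inner n (q : 'S_m) (t : 'S_M) (tau : 'S_n) :
    m * B <= n -> (forall x, x < n -> pnat tau x = inflate_fun B q t x) ->
  blockwise (m * B) 1 t tau.
Proof.
move=> mn tauE x y xm ym; rewrite mul1n !divn1 => exy dxy.
rewrite !tauE ?(leq_trans _ mn) // /inflate_fun xm ym.
rewrite /B !divnMA exy ltn_add2l.
have E z : z %% (M * r) %/ M = (z %/ M) %% r by rewrite mulnC -modn_divl.
by rewrite !E exy ltn_add2l.
Qed.
End Inflate.

Lemma inflateP m M r n (q : 'S_m) (t : 'S_M) :
    0 < M -> 0 < r -> m * (M * r) <= n ->
  exists tau : 'S_n,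
    [/\ blockwise (m * (M * r)) (M * r) q tau,
        blockwise (m * (M * r)) 1 t tau,
        blockwise (m * (M * r)) (M * r) q^-1%g tau^-1%g &
        blockwise (m * (M * r)) 1 t^-1%g tau^-1%g].
Proof.
move=> M0 r0 mn.
have [] := @nat_perm n (inflate_fun (M * r) q t) (inflate_fun (M * r) q^-1%g t^-1%g).
- move=> x xn; have [xm|xm] := boolP (x < m * (M * r)).
    by apply: leq_trans mn; apply: inflate_fun_lt.
  by rewrite /inflate_fun (negbTE xm).
- by move=> x _; apply: inflate_funK.
move=> tau [tE tVE]; exists tau; split.
- exact: blockwise_inflate_outer tE.
- exact: blockwise_inflate_inner tE.
- exact: blockwise_inflate_outer tVE.
- exact: blockwise_inflate_inner tVE.
Qed.

(* With positions written [u * a + v] and values [v' * b + u'], this is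
   [v' = A v, u' = B u]: windows of positions see only [A], and windows of
   values see only [B]. *)
Definition cross_fun a b (A : 'S_a) (B : 'S_b) (x : nat) : nat :=
  pnat A (x %% a) * b + pnat B (x %/ a).

Section Cross.
Variables (a b : nat) (A : 'S_a) (B : 'S_b).

Lemma cross_fun_lt x : x < a * b -> cross_fun A B x < a * b.
Proof.
move=> xab; have a0 : 0 < a by move: xab; case: (a).
by rewrite digit_lt ?pnat_lt ?ltn_mod // ltn_divLR // mulnC.
Qed.

Lemma cross_funK x : x < a * b -> cross_fun B^-1%g A^-1%g (cross_fun A B x) = x.
Proof.
move=> xab; have a0 : 0 < a by move: xab; case: (a).
have xb : x %/ a < b by rewrite ltn_divLR // mulnC.
rewrite /cross_fun modn_digit ?divn_digit ?pnat_lt //.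
by rewrite !pnatK ?ltn_mod // -divn_eq.
Qed.

Lemma blockwise_cross n (q : 'S_n) :
    n = a * b -> (forall x, x < n -> pnat q x = cross_fun A B x) ->
  blockwise n 1 A q.
Proof.
move=> nE qE x y xn yn; rewrite mul1n !divn1 => exy dxy.
have a0 : 0 < a by move: xn; rewrite nE; case: (a).
have lb z : z < n -> z %/ a < b by rewrite ltn_divLR // [b * a]mulnC nE.
rewrite !qE // /cross_fun ltn_digit ?pnat_lt ?lb //.
by apply: contraNneq dxy => /(congr1 (pnat A^-1%g)); rewrite !pnatK ?ltn_mod // => ->.
Qed.
End Cross.

Lemma crossP a b (A : 'S_a) (B : 'S_b) :
  exists q : 'S_(a * b), blockwise (a * b) 1 A q /\ blockwise (a * b) 1 B q^-1%g.
Proof.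
(* [B] enters inverted, so that in the inverse it is [B] itself that acts on the leading digit. *)
have [] := @nat_perm (a * b) (cross_fun A B^-1%g) (cross_fun B A^-1%g).
- exact: cross_fun_lt.
- by move=> x xab; rewrite -{1}[B]invgK cross_funK.
move=> q [qE qVE]; exists q; split; first exact: (blockwise_cross _ qE).
by apply: (blockwise_cross _ qVE); rewrite mulnC.
Qed.

(** * Windows and densities *)

Lemma leq_card_in_inj (T U : finType) (A : pred T) (B : pred U) (f : T -> U) :
  {in A &, injective f} -> (forall x, A x -> B (f x)) -> #|A| <= #|B|.
Proof.
move=> fi fAB; rewrite -(card_in_image fi); apply: subset_leq_card.
by apply/fintype.subsetP => y /mapP[x]; rewrite mem_enum => xA ->; exact: fAB.
Qed.

Lemma incrP k n (g : {ffun 'I_k -> 'I_n}) :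
  reflect (forall a b : 'I_k, a < b -> g a < g b) (incr g).
Proof.
apply: (iffP idP) => [/forallP h a b ab|h].
  by move/(_ a)/forallP/(_ b)/implyP: h; apply.
by apply/forallP => a; apply/forallP => b; apply/implyP/h.
Qed.

Lemma incr_inj k n (g : {ffun 'I_k -> 'I_n}) : incr g -> injective g.
Proof.
move=> /incrP h a b; have [/h ab|/h ab|/ord_inj //] := ltngtP a b => e.
  by rewrite e ltnn in ab.
by rewrite e ltnn in ab.
Qed.

Lemma incr_leq k n (g : {ffun 'I_k -> 'I_n}) (a b : 'I_k) :
  incr g -> a <= b -> g a <= g b.
Proof.
by move=> /incrP h; rewrite leq_eqVlt => /orP[/eqP/ord_inj -> //|/h/ltnW].
Qed.

Lemma widthP k n (g : {ffun 'I_k -> 'I_n}) F : 0 < F ->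
  reflect (forall a b : 'I_k, g b - g a < F) (width g <= F).
Proof.
case: F => // F _; rewrite /width ltnS.
apply: (iffP (bigop.bigmax_leqP _ _ _)) => [h a b|h a _]; last by apply/bigop.bigmax_leqP => b _; exact: h.
by have /bigop.bigmax_leqP/(_ b isT) := h a isT.
Qed.

Definition nwin k n F :=
  #|[pred g : {ffun 'I_k -> 'I_n} | incr g && (width g <= F)]|.

Definition nocc k n F (pi : 'S_k) (sigma : 'S_n) :=
  #|[pred g : {ffun 'I_k -> 'I_n} | incr g && (width g <= F) && occ pi sigma g]|.

Lemma rho_natE (R : realType) F k n (pi : 'S_k) (sigma : 'S_n) :
  rho (F%:R : R) pi sigma = ((nocc F pi sigma)%:R / (nwin k n F)%:R)%R.
Proof.
rewrite /rho /nocc /nwin; congr (_%:R / _%:R)%R; apply: eq_card => g;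
  rewrite !inE /=; by apply/asboolP/idP; rewrite /mkset ler_nat.
Qed.

(** Widths are positive integers, so truncating the threshold loses nothing, even for a negative
    [f], which truncates to 0. *)
Lemma rho_truncn (R : realType) (f : R) k n (pi : 'S_k) (sigma : 'S_n) :
  rho f pi sigma = rho ((Num.truncn f)%:R : R) pi sigma.
Proof.
have E (g : {ffun 'I_k -> 'I_n}) :
    (((width g)%:R : R) <= f)%R = (((width g)%:R : R) <= (Num.truncn f)%:R)%R.
  by rewrite ler_nat /width truncn_gt_nat.
rewrite /rho; congr (_%:R / _%:R)%R; apply: eq_card => g;
  by apply/idP/idP; rewrite !in_setE /mkset E.
Qed.

Lemma nocc_le k n F (pi : 'S_k) (sigma : 'S_n) : nocc F pi sigma <= nwin k n F.
Proof.
apply: subset_leq_card; apply/fintype.subsetP => g; rewrite !inE => /andP[] //.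
Qed.

Lemma nocc_compl k n F (pi : 'S_k) (sigma : 'S_n) :
  nwin k n F - nocc F pi sigma =
  #|[pred g : {ffun 'I_k -> 'I_n} | incr g && (width g <= F) && ~~ occ pi sigma g]|.
Proof.
set v := #|_|; suff -> : nwin k n F = nocc F pi sigma + v by rewrite addKn.
rewrite /nwin -(cardID [pred g | occ pi sigma g]) /nocc /v.
by congr (_ + _); apply: eq_card => g; rewrite !inE // andbC.
Qed.

(** The only empty window has width 1 by convention; below this threshold the quotient is
    [0 / 0 = 0]. The empty pattern is treated apart because lifting windows is injective only for
    [0 < k]. *)
Lemma rho0 (R : realType) (f : R) n (pi : 'S_0) (sigma : 'S_n) :
  rho f pi sigma = if (1 <= f)%R then 1%R else 0%R.
Proof.
rewrite rho_truncn rho_natE.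
have i0 (g : {ffun 'I_0 -> 'I_n}) : incr g by apply/incrP => -[].
have w0 (g : {ffun 'I_0 -> 'I_n}) : width g = 1 by rewrite /width big_ord0.
have o0 (g : {ffun 'I_0 -> 'I_n}) : occ pi sigma g by apply/forallP => -[].
have -> : nocc (Num.truncn f) pi sigma = nwin 0 n (Num.truncn f).
  by apply: eq_card => g; rewrite !inE o0 andbT.
have -> : nwin 0 n (Num.truncn f) = (0 < Num.truncn f) :> nat.
  rewrite /nwin; have [t0|t0] := boolP (0 < Num.truncn f).
    rewrite (eq_card (B := {: {ffun 'I_0 -> 'I_n}})).
      by rewrite card_ffun !card_ord.
    by move=> g; rewrite !inE i0 w0.
  by apply: eq_card0 => g; rewrite !inE i0 w0 (negbTE t0).
rewrite truncn_gt0; case: ifP => _; first by rewrite divr1.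
by rewrite mul0r.
Qed.

Lemma card_incr k n : #|[pred g : {ffun 'I_k -> 'I_n} | incr g]| = 'C(n, k).
Proof.
rewrite -card_ltn_sorted_tuples cardsE; apply/eqP; rewrite eqn_leq; apply/andP; split.
- apply: (@leq_card_in_inj _ _ _ _ (fun g : {ffun 'I_k -> 'I_n} => [tuple g i | i < k])).
    move=> g h _ _ e; apply/ffunP => i.
    by move/(congr1 (fun t => tnth t i)): e; rewrite !tnth_mktuple.
  move=> g /= /incrP gi; rewrite -map_comp.
  rewrite sorted_pairwise; last exact: ltn_trans.
  rewrite pairwise_map; apply: (@sub_pairwise _ (relpre val ltn)) => //.
  rewrite -pairwise_map val_enum_ord -sorted_pairwise; last exact: ltn_trans.
  exact: iota_ltn_sorted.
- apply: (@leq_card_in_inj _ _ _ _ (fun t : k.-tuple 'I_n => [ffun i => tnth t i])).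
    move=> t u _ _ /ffunP e; apply/eq_from_tnth => i; have := e i.
    by rewrite !ffunE.
  move=> t /=.
  rewrite sorted_pairwise; last exact: ltn_trans.
  move=> st; apply/incrP => a b ab; rewrite !ffunE.
  move: st; rewrite pairwise_map => /(pairwiseP (tnth t a)).
  move/(_ a b); rewrite !inE size_tuple !ltn_ord => /(_ isT isT ab) /=.
  by rewrite -!tnth_nth.
Qed.

(** * Transfer of densities along lifts *)

Lemma nwin_full k n F : n <= F -> 0 < F -> nwin k n F = 'C(n, k).
Proof.
move=> nF F0; rewrite -card_incr; apply: eq_card => g; rewrite !inE.
case: (incr g) => //=; apply/widthP => // a b.
by rewrite (leq_trans _ nF) // (leq_ltn_trans (leq_subr _ _)).
Qed.

Lemma nwin1_le n F : nwin 1 n F <= n.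
Proof.
apply: (@leq_trans #|{: {ffun 'I_1 -> 'I_n}}|); first exact: max_card.
by rewrite card_ffun !card_ord expn1.
Qed.

(* A window of width at most [F.+2] is its first position together with a
   [k]-subset of the next [F.+1] positions. *)
Lemma nwin_le k n F : nwin k.+1 n F.+2 <= n * 'C(F.+1, k).
Proof.
rewrite -card_incr -{2}(card_ord n) -cardX.
pose f (g : {ffun 'I_k.+1 -> 'I_n}) : 'I_n * {ffun 'I_k -> 'I_F.+1} :=
  (g ord0, [ffun i => inord (g (lift ord0 i) - (g ord0).+1)]).
have fE (g : {ffun 'I_k.+1 -> 'I_n}) i : incr g -> width g <= F.+2 ->
    (g (lift ord0 i) : nat) = (g ord0).+1 + (f g).2 i.
  move=> /incrP gi /widthP gw; rewrite ffunE inordK.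
    by rewrite subnKC //; apply: gi.
  by have := gw isT ord0 (lift ord0 i); have := gi ord0 (lift ord0 i) isT; lia.
apply: (@leq_card_in_inj _ _ _ _ f).
  move=> g h /andP[gi gw] /andP[hi hw] e; apply/ffunP => i; apply/val_inj => /=.
  have e0 : g ord0 = h ord0 := congr1 fst e.
  by have [j ->|->] := unliftP ord0 i; rewrite ?e0 // !fE // e e0.
move=> g /andP[gi gw]; rewrite !inE /=; apply/incrP => a b ab.
have := elimT (incrP g) gi (lift ord0 a) (lift ord0 b); rewrite !fE // ltn_add2l.
by apply; rewrite ltnS.
Qed.

(** Any first position below [s - w], together with any [k]-subset of the [w.-1] positions that
    follow it, forms a window. *)
Lemma nwin_ge k s w : 0 < w -> (s - w) * 'C(w.-1, k) <= nwin k.+1 s w.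
Proof.
case: w => // w _.
rewrite /= -card_incr -{1}(card_ord (s - w.+1)) -cardX.
have lt (j : 'I_(s - w.+1)) (z : nat) : z <= w -> j + z < s.
  by move=> zw; move: (ltn_ord j) => /=; lia.
pose f (x : 'I_(s - w.+1) * {ffun 'I_k -> 'I_w}) : {ffun 'I_k.+1 -> 'I_s} :=
  [ffun i => if unlift ord0 i is Some j then Ordinal (lt x.1 _ (ltn_ord (x.2 j)))
             else Ordinal (lt x.1 0 (leq0n w))].
have f0 x : f x ord0 = x.1 :> nat by rewrite ffunE unlift_none /= addn0.
have fS x i : f x (lift ord0 i) = (x.1 + (x.2 i).+1)%N :> nat by rewrite ffunE liftK.
apply: (@leq_card_in_inj _ _ _ _ f).
  move=> x y _ _ e.
  have e1 : x.1 = y.1 by apply/val_inj; rewrite /= -!f0 e.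
  rewrite (surjective_pairing x) (surjective_pairing y) e1; congr (_, _).
  apply/ffunP => i; apply/val_inj => /=.
  by have := fS x i; rewrite e fS e1 => /addnI[].
move=> x /andP[_ /incrP xi]; apply/andP; split.
  apply/incrP => a b; have [j ->|->] := unliftP ord0 a; have [i ->|->] := unliftP ord0 b;
    rewrite ?f0 ?fS //= ?ltn_add2l ?ltnS => ij.
  - by apply: xi; rewrite -ltnS.
  - by rewrite -[ltnLHS]addn0 ltn_add2l.
apply/widthP => // a b.
have h i : x.1 <= f x i <= x.1 + w.
  have [j ->|->] := unliftP ord0 i; rewrite ?f0 ?fS ?leqnn ?leq_addr //.
  by rewrite leq_add2l ltn_ord.
by have /andP[_ hb] := h b; have /andP[ha _] := h a; lia.
Qed.

Section Lift.
Variables (k n q b s : nat).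
Hypothesis le_n : q * (b * s) <= n.

Lemma lift_lt (j : 'I_q) (v : 'I_s) (e : 'I_b) : j * (b * s) + (v * b + e) < n.
Proof.
apply: leq_trans le_n; rewrite digit_lt // [ltnRHS]mulnC digit_lt //.
Qed.

(** The components of [x] are a frame, the offsets inside the blocks, and a window of block indices.
    A window of [sigma] thus has [q * b ^ k] lifts. *)
Definition lift_win (x : 'I_q * {ffun 'I_k -> 'I_b} * {ffun 'I_k -> 'I_s}) :
    {ffun 'I_k -> 'I_n} :=
  [ffun i => Ordinal (lift_lt x.1.1 (x.2 i) (x.1.2 i))].

Lemma lift_winE x i : lift_win x i =
  x.1.1 * (b * s) + (x.2 i * b + x.1.2 i) :> nat.
Proof. by rewrite ffunE. Qed.

Lemma lift_low (x : 'I_q * {ffun 'I_k -> 'I_b} * {ffun 'I_k -> 'I_s}) (i : 'I_k) : x.2 i * b + x.1.2 i < b * s.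
Proof. by case: x => [[j e] g] /=; rewrite [ltnRHS]mulnC digit_lt. Qed.

Lemma lift_win_frame x i : lift_win x i %/ (b * s) = x.1.1.
Proof. by rewrite lift_winE divn_digit ?lift_low. Qed.

Lemma lift_win_block x i : (lift_win x i %/ b) %% s = x.2 i.
Proof.
rewrite lift_winE -[b * s]mulnC mulnA addnA -mulnDl divn_digit //.
by rewrite modn_digit.
Qed.

Lemma lift_win_inj : 0 < k -> injective lift_win.
Proof.
move=> k0 [[j e] g] [[j' e'] g'] E.
have gE : g = g'.
  by apply/ffunP => i; apply/val_inj; rewrite /= -(lift_win_block (j, e, g)) E lift_win_block.
have jE : j = j'.
  apply/val_inj; rewrite /= -(lift_win_frame (j, e, g) (Ordinal k0)) E.
  by rewrite lift_win_frame.
rewrite {}gE {}jE in E *; congr (_, _, _); apply/ffunP => i; apply/val_inj => /=.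
by have := lift_winE (j', e, g') i; rewrite E lift_winE /= => /addnI/addnI.
Qed.

Lemma incr_lift_win x : incr x.2 -> incr (lift_win x).
Proof.
move=> /incrP xi; apply/incrP => a c /xi ac; rewrite !lift_winE ltn_add2l.
by rewrite ltn_digit //; lia.
Qed.

Lemma width_lift_win x w F : 0 < k -> b * w <= F -> width x.2 <= w -> width (lift_win x) <= F.
Proof.
move=> k0 bwF xw; have w0 : 0 < w by apply: leq_trans xw.
case: x xw => [[j e] g] /= /(widthP _ w0) gw.
have b0 : 0 < b by apply: leq_ltn_trans (ltn_ord (e (Ordinal k0))).
apply/widthP; first by apply: leq_trans bwF; rewrite muln_gt0 b0.
move=> a c; rewrite !lift_winE subnDl /=; apply: leq_trans bwF.
by have := gw a c; have := ltn_ord (e a); have := ltn_ord (e c); nia.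
Qed.

(** The predicates are kept abstract to cover occurrences, non-occurrences and all windows at
    once. *)
Lemma card_lift_win w F (P0 : pred {ffun 'I_k -> 'I_s}) (P : pred {ffun 'I_k -> 'I_n}) :
    0 < k -> b * w <= F ->
    (forall x, incr x.2 -> P0 x.2 -> P (lift_win x)) ->
  q * b ^ k * #|[pred g : {ffun 'I_k -> 'I_s} | incr g && (width g <= w) && P0 g]| <=
  #|[pred g : {ffun 'I_k -> 'I_n} | incr g && (width g <= F) && P g]|.
Proof.
move=> k0 bwF PP.
have -> : q * b ^ k = #|{: 'I_q * {ffun 'I_k -> 'I_b}}|.
  by rewrite card_prod card_ffun !card_ord.
rewrite -cardX; apply: (@leq_card_in_inj _ _ _ _ lift_win).
  by move=> x y _ _; apply: lift_win_inj.
move=> x /andP[_ /andP[/andP[xi xw] xP]].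
by rewrite /= incr_lift_win // (width_lift_win k0 bwF) // PP.
Qed.

Lemma occ_lift_win Q (pi : 'S_k) (sigma : 'S_s) (tau : 'S_n) x :
    blockwise Q b sigma tau -> q * (b * s) <= Q -> incr x.2 ->
  occ pi tau (lift_win x) = occ pi sigma x.2.
Proof.
move=> bw qQ xi.
have lQ i : lift_win x i < Q.
  by rewrite lift_winE (leq_trans _ qQ) // digit_lt ?lift_low.
apply: eq_forallb => a; apply: eq_forallb => c; congr (_ == _).
have [->|ac] := eqVneq a c; first by rewrite !ltnn.
rewrite -!pnatE (bw _ _ (lQ a) (lQ c)) ?lift_win_frame // !lift_win_block //.
by apply: contraNneq ac => /ord_inj/(incr_inj xi) ->.
Qed.
End Lift.

(** Here [x] and [y] count windows below and above, [xP] and [yP] occurrences, and [c] is the number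
    of lifts of a window. Occurrences and non-occurrences both lift, and the lifts miss at most a
    fraction [d] of [y]; this bounds the density from both sides. *)
Lemma density_close (R : realFieldType) (c x xP y yP d : R) :
  (0 <= c -> 0 <= xP <= x -> 0 <= yP <= y -> c * xP <= yP -> c * (x - xP) <= y - yP ->
   (1 - d) * y <= c * x -> 0 <= d -> 0 < y -> `|yP / y - xP / x| <= d)%R.
Proof.
move=> c0 /andP[xP0 xPx] /andP[yP0 yPy] h1 h2 h3 d0 y0.
(* With no window below, the covering hypothesis forces [1 <= d], and a density never exceeds 1. *)
have [x0|x0] := eqVneq x 0%R.
  have d1 : (1 <= d)%R.
    by move: h3; rewrite x0 mulr0 pmulr_lle0 // subr_le0.
  rewrite x0 invr0 mulr0 subr0 ger0_norm ?divr_ge0 //; last exact: ltW.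
  by apply: le_trans d1; rewrite ler_pdivrMr // mul1r.
have {}x0 : (0 < x)%R by rewrite lt_neqAle eq_sym x0 (le_trans xP0).
have [p [xPE p0 p1]] : exists p, [/\ xP = p * x, 0 <= p & p <= 1]%R.
  exists (xP / x)%R; rewrite mulfVK ?gt_eqF // divr_ge0 ?(ltW x0) //.
  by rewrite ler_pdivrMr // mul1r.
have [r [yPE r0 r1]] : exists r, [/\ yP = r * y, 0 <= r & r <= 1]%R.
  exists (yP / y)%R; rewrite mulfVK ?gt_eqF // divr_ge0 ?(ltW y0) //.
  by rewrite ler_pdivrMr // mul1r.
rewrite xPE yPE !mulfK ?gt_eqF // in h1 h2 *.
have : ((1 - d) * p <= r)%R.
  by rewrite -(ler_pM2r y0); apply: le_trans h1; nra.
have : ((1 - d) * (1 - p) <= 1 - r)%R.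
  by rewrite -(ler_pM2r y0); apply: (@le_trans _ _ ((1 - p) * (c * x))%R); nra.
by move=> u v; rewrite ler_norml; apply/andP; split; nra.
Qed.

Lemma blockwise_density (R : realType) (d : R) Q n q b s w F k
    (pi : 'S_k) (sigma : 'S_s) (tau : 'S_n) :
    0 < k -> blockwise Q b sigma tau -> q * (b * s) <= Q -> q * (b * s) <= n ->
    b * w <= F -> 0 < nwin k n F -> (0 <= d)%R ->
    ((1 - d) * (nwin k n F)%:R <= (q * b ^ k * nwin k s w)%:R)%R ->
  (`|rho (F%:R : R) pi tau - rho (w%:R : R) pi sigma| <= d)%R.
Proof.
move=> k0 bw qQ qn bwF y0 d0 hd; rewrite !rho_natE.
apply: (@density_close _ (q * b ^ k)%:R) => //.
- by rewrite ler0n ler_nat nocc_le.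
- by rewrite ler0n ler_nat nocc_le.
- rewrite -natrM ler_nat; apply: (card_lift_win (le_n := qn)) => // x xi.
  by rewrite (occ_lift_win _ _ bw).
- rewrite -!natrB ?nocc_le // -natrM ler_nat !nocc_compl.
  apply: (card_lift_win (le_n := qn)) => // x xi.
  by rewrite (occ_lift_win _ _ bw).
- by rewrite -natrM.
- by rewrite ltr0n.
Qed.

Lemma nwin_lift k n q b s w F : q * (b * s) <= n -> 0 < k -> b * w <= F ->
  q * b ^ k * nwin k s w <= nwin k n F.
Proof.
move=> qn k0 bwF.
have E m G : nwin k m G =
    #|[pred g : {ffun 'I_k -> 'I_m} | incr g && (width g <= G) && true]|.
  by apply: eq_card => g; rewrite !inE andbT.
by rewrite !E; apply: (card_lift_win (le_n := qn)).
Qed.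

Lemma ffact_leX m j : m ^_ j <= m ^ j.
Proof.
by elim: j => // j IH; rewrite ffactnSr expnSr leq_mul // leq_subr.
Qed.

Lemma ffact_geX m J j : j <= J -> (m - J) ^ j <= m ^_ j.
Proof.
elim: j => // j IH jJ; rewrite ffactnSr expnSr.
by apply: leq_mul; [exact: IH (ltnW jJ)|exact: leq_sub2l (ltnW jJ)].
Qed.

Lemma bernoulli_le (R : realDomainType) (d : R) j :
  (0 <= d <= 1 -> 1 - j%:R * d <= (1 - d) ^+ j)%R.
Proof.
move=> /andP[d0 d1]; elim: j => [|j IH]; first by rewrite mul0r subr0 expr0.
have j0 : (0 <= j%:R :> R)%R by rewrite ler0n.
have : ((1 - d) * (1 - j%:R * d) <= (1 - d) ^+ j.+1)%R.
  by rewrite exprS ler_wpM2l // subr_ge0.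
by apply: le_trans; rewrite -natr1; nra.
Qed.

(** * Error bounds at intermediate, local and global scales *)

Section Quantitative.
Variables (R : realType) (d : R).
Hypothesis d01 : (0 <= d <= 1)%R.
Let d0 : (0 <= d)%R. Proof. by case/andP: d01. Qed.
Let d1 : (0 <= 1 - d)%R. Proof. by case/andP: d01; rewrite subr_ge0. Qed.

(** The lifts miss windows in three ways, each costing factors [1 - d]: positions beyond the [q]
    frames (one), first blocks near the end of a frame (one), and the choice of each of the [k - 1]
    later entries within [F] (one each). Bernoulli's inequality turns the [k + 1] factors into the
    bound. *)
Lemma scale_density Q n q b s w F k (pi : 'S_k) (sigma : 'S_s) (tau : 'S_n) :
    0 < k -> blockwise Q b sigma tau -> q * (b * s) <= Q -> Q <= n ->
    0 < q -> 0 < b -> w < s -> k <= w -> 1 < w -> b * w <= F ->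
    ((1 - d) * n%:R <= (q * (b * s))%:R)%R ->
    ((1 - d) * s%:R <= (s - w)%:R)%R ->
    ((1 - d) * F%:R <= (b * (w - k))%:R)%R ->
  (`|rho (F%:R : R) pi tau - rho (w%:R : R) pi sigma| <= k.+1%:R * d)%R.
Proof.
case: k pi => // k pi _ bw qQ Qn q0 b0 ws kw w1 bwF hn hs hF.
have lb := @nwin_ge k s w (ltnW w1).
have qn := leq_trans qQ Qn.
have y0 : 0 < nwin k.+1 n F.
  apply: (@leq_trans (q * b ^ k.+1 * nwin k.+1 s w)).
    rewrite !muln_gt0 q0 expn_gt0 b0 (leq_trans _ lb) // muln_gt0 subn_gt0 ws bin_gt0.
    by move: kw; case: (w).
  exact: nwin_lift.
have F2 : 1 < F by nia.
apply: (blockwise_density _ _ bw qQ qn bwF y0) => //; first by rewrite mulr_ge0.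
have ub : nwin k.+1 n F * k`! <= n * F ^ k.
  case: F F2 {bwF hF y0} => [|[|F]] // _.
  apply: (@leq_trans (n * 'C(F.+1, k) * k`!)); first by rewrite leq_mul2r nwin_le orbT.
  rewrite -mulnA bin_ffact leq_mul2l; apply/orP; right.
  (* Multiplying by the factorial replaces binomials by falling factorials, which are compared with
     powers. *)
  by apply: leq_trans (ffact_leX _ _) _; case: (k) => // j; rewrite leq_exp2r.
have {}lb : (q * (b * (s - w))) * (b * (w - k.+1)) ^ k <=
            q * b ^ k.+1 * nwin k.+1 s w * k`!.
  apply: (@leq_trans (q * b ^ k.+1 * ((s - w) * 'C(w.-1, k)) * k`!)); last first.
    by rewrite leq_mul2r leq_mul2l lb !orbT.
  rewrite -!mulnA bin_ffact.
  have -> : w - k.+1 = w.-1 - k by lia.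
  rewrite expnMn expnS -!mulnA leq_mul2l; apply/orP; right.
  rewrite leq_mul2l; apply/orP; right.
  by rewrite mulnCA leq_mul2l leq_mul2l ffact_geX // !orbT.
have kf : (0 < (k`!)%:R :> R)%R by rewrite ltr0n fact_gt0.
rewrite -(ler_pM2r kf) -mulrA -!natrM.
apply: (@le_trans _ _ (q * (b * (s - w)) * (b * (w - k.+1)) ^ k)%:R%R); last first.
  by rewrite ler_nat.
have b1 := @bernoulli_le R d k.+2 d01.
have [c0|c0] := leP (1 - k.+2%:R * d)%R 0%R.
  apply: (@le_trans _ _ 0%R); last by rewrite ler0n.
  by rewrite mulr_le0_ge0.
apply: (@le_trans _ _ ((1 - k.+2%:R * d) * (n * F ^ k)%:R)%R).
  by rewrite ler_pM2l // ler_nat.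
apply: (@le_trans _ _ ((1 - d) ^+ k.+2 * (n * F ^ k)%:R)%R).
  by rewrite ler_wpM2r.
have -> : ((1 - d) ^+ k.+2 * (n * F ^ k)%:R =
  ((1 - d) * ((1 - d) * n%:R)) * ((1 - d) * F%:R) ^+ k :> R)%R.
  by rewrite natrM natrX exprMn !exprS; ring.
rewrite natrM [X in (_ <= _ * X)%R]natrX.
apply: ler_pM; rewrite ?exprn_ge0 ?mulr_ge0 //; last first.
  by apply: lerXn2r; rewrite ?nnegrE ?mulr_ge0.
rewrite mulnA natrM.
apply: (@le_trans _ _ ((1 - d) * (q * (b * s))%:R)%R); first by rewrite ler_wpM2l.
by rewrite mulnA natrM mulrCA ler_wpM2l.
Qed.

(** A consecutive window is determined by its first position, so only the first two losses of
    [scale_density] remain. *)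
Lemma local_density Q n q s k (pi : 'S_k) (sigma : 'S_s) (tau : 'S_n) :
    0 < k -> blockwise Q 1 sigma tau -> q * s <= Q -> Q <= n ->
    0 < q -> k < s ->
    ((1 - d) * n%:R <= (q * s)%:R)%R -> ((1 - d) * s%:R <= (s - k)%:R)%R ->
  (`|rho (k%:R : R) pi tau - rho (k%:R : R) pi sigma| <= 2 * d)%R.
Proof.
case: k pi => // k pi _ bw qQ Qn q0 ks hn hs.
have lb := @nwin_ge k s k.+1 isT; rewrite binn muln1 in lb.
have qn := leq_trans qQ Qn.
have e : q * s = q * (1 * s) by rewrite mul1n.
rewrite e in qQ qn.
have bwF : 1 * k.+1 <= k.+1 by rewrite mul1n.
have y0 : 0 < nwin k.+1 n k.+1.
  apply: (@leq_trans (q * 1 ^ k.+1 * nwin k.+1 s k.+1)).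
    by rewrite !muln_gt0 q0 exp1n (leq_trans _ lb) // subn_gt0.
  exact: nwin_lift.
apply: (blockwise_density _ _ bw qQ qn bwF y0) => //; first by rewrite mulr_ge0.
have ub : nwin k.+1 n k.+1 <= n.
  case: (k) => [|j]; first exact: nwin1_le.
  by apply: leq_trans (nwin_le _ _ _) _; rewrite binn muln1.
have b2 := @bernoulli_le R d 2 d01.
have [c0|c0] := leP (1 - 2 * d)%R 0%R.
  by apply: (@le_trans _ _ 0%R); rewrite ?ler0n // mulr_le0_ge0.
apply: (@le_trans _ _ ((1 - 2 * d) * n%:R)%R); first by rewrite ler_pM2l // ler_nat.
apply: (@le_trans _ _ ((1 - d) * ((1 - d) * n%:R))%R).
  by rewrite mulrA -expr2 ler_wpM2r.
apply: (@le_trans _ _ ((1 - d) * (q * s)%:R)%R); first by rewrite ler_wpM2l.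
rewrite exp1n muln1 !natrM mulrCA ler_wpM2l //.
by apply: le_trans hs _; rewrite ler_nat.
Qed.

(** With a single frame, windows are arbitrary [k]-subsets. Keeping the entries in distinct blocks
    leaves at least [b * (s - k)] choices out of [n] for each of the [k] entries. *)
Lemma global_density Q n b s k (pi : 'S_k) (sigma : 'S_s) (tau : 'S_n) :
    0 < k -> blockwise Q b sigma tau -> b * s <= Q -> Q <= n ->
    k <= n -> 0 < s ->
    ((1 - d) * n%:R <= (b * (s - k))%:R)%R ->
  (`|rho (n%:R : R) pi tau - rho (s%:R : R) pi sigma| <= k%:R * d)%R.
Proof.
move=> k0 bw qQ Qn kn s0 hn.
have n0 := leq_trans k0 kn.
have y0 : 0 < nwin k n n by rewrite nwin_full // bin_gt0.
have qQ' : 1 * (b * s) <= Q by rewrite mul1n.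
apply: (blockwise_density _ _ bw qQ' (leq_trans qQ' Qn) (leq_trans qQ Qn) y0) => //.
  by rewrite mulr_ge0.
rewrite !nwin_full // mul1n.
have kf : (0 < (k`!)%:R :> R)%R by rewrite ltr0n fact_gt0.
rewrite -(ler_pM2r kf) -mulrA -!natrM -mulnA !bin_ffact.
have b2 := @bernoulli_le R d k d01.
apply: (@le_trans _ _ ((1 - d) ^+ k * (n ^ k)%:R)%R).
  apply: (@le_trans _ _ ((1 - d) ^+ k * (n ^_ k)%:R)%R); first by rewrite ler_wpM2r.
  by rewrite ler_wpM2l ?exprn_ge0 // ler_nat ffact_leX.
rewrite natrX -exprMn.
apply: (@le_trans _ _ ((b * (s - k)) ^ k)%:R%R).
  by rewrite natrX; apply: lerXn2r; rewrite ?nnegrE ?mulr_ge0.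
by rewrite ler_nat expnMn leq_mul2l ffact_geX ?orbT.
Qed.
End Quantitative.

Local Open Scope classical_set_scope.
Local Open Scope ring_scope.

(** * Iterated integrals of step functions *)

(** The discrete counterpart of [iter_int], with the same recursion: for weights of total 1, the
    expectation of [phi] over [k] independent letters. *)
Fixpoint wsum (R : pzRingType) (C : finType) (w : C -> R) (k : nat) (phi : seq C -> R) : R :=
  if k is k'.+1 then \sum_(c : C) w c * wsum w k' (fun s => phi (c :: s))
  else phi [::].

Lemma eq_wsum (R : pzRingType) (C : finType) (w : C -> R) k (phi psi : seq C -> R) :
  (forall s, size s = k -> phi s = psi s) -> wsum w k phi = wsum w k psi.
Proof.
elim: k phi psi => [|k IH] phi psi h /=; first exact: h.
by apply: eq_bigr => c _; congr (_ * _); apply: IH => s sk; rewrite h //= sk.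
Qed.

Lemma wsum_cst (R : pzRingType) (C : finType) (w : C -> R) k a :
  \sum_c w c = 1 -> wsum w k (fun=> a) = a.
Proof. by move=> w1; elim: k => //= k ->; rewrite -mulr_suml w1 mul1r. Qed.

Lemma wsumD (R : pzRingType) (C : finType) (w : C -> R) k (phi psi : seq C -> R) :
  wsum w k (fun s => phi s + psi s) = wsum w k phi + wsum w k psi.
Proof.
elim: k phi psi => [|k IH] phi psi //=.
by rewrite -big_split; apply: eq_bigr => c _ /=; rewrite IH mulrDr.
Qed.

Lemma wsumZ (R : comPzRingType) (C : finType) (w : C -> R) k (a : R) (phi : seq C -> R) :
  wsum w k (fun s => a * phi s) = a * wsum w k phi.
Proof.
elim: k phi => [|k IH] phi //=.
by rewrite mulr_sumr; apply: eq_bigr => c _ /=; rewrite IH mulrCA.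
Qed.

Lemma wsum_ge0 (R : realDomainType) (C : finType) (w : C -> R) k (phi : seq C -> R) :
  (forall c, 0 <= w c) -> (forall s, 0 <= phi s) -> 0 <= wsum w k phi.
Proof.
move=> w0; elim: k phi => [|k IH] phi h //=.
by rewrite sumr_ge0 // => c _; rewrite mulr_ge0 ?IH.
Qed.

Lemma wsum_le (R : realDomainType) (C : finType) (w : C -> R) k (phi psi : seq C -> R) :
  (forall c, 0 <= w c) -> (forall s, size s = k -> phi s <= psi s) ->
  wsum w k phi <= wsum w k psi.
Proof.
move=> w0; elim: k phi psi => [|k IH] phi psi h /=; first exact: h.
by apply: ler_sum => c _; rewrite ler_wpM2l // IH // => s sk; rewrite h //= sk.
Qed.

Lemma wsum_scale (R : comPzRingType) (C : finType) (w : C -> R) (a : R) k (phi : seq C -> R) :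
  wsum (fun c => a * w c) k phi = a ^+ k * wsum w k phi.
Proof.
elim: k phi => [|k IH] phi /=; first by rewrite mul1r.
by rewrite mulr_sumr; apply: eq_bigr => c _; rewrite IH exprS; ring.
Qed.

Lemma cvg_wsum (R : realType) (C : finType) (u : nat -> C -> R) (w : C -> R) k (phi : seq C -> R) :
  (forall c, u m c @[m --> \oo] --> w c) ->
  wsum (u m) k phi @[m --> \oo] --> wsum w k phi.
Proof.
move=> uw; elim: k phi => [|k IH] phi /=; first exact: cvg_cst.
by apply: cvg_big => [|c _]; [exact: add_continuous|exact: cvgM].
Qed.

(* No measurability is needed: the integral of a nonnegative function is a
   supremum over the simple functions below it. *)
Lemma ge0_le_integral_nomeas d (T : measurableType d) (R : realType)
    (mu : {measure set T -> \bar R}) (f g : T -> \bar R) :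
  (forall x, (0 <= f x)%E) -> (forall x, (f x <= g x)%E) ->
  (\int[mu]_x f x <= \int[mu]_x g x)%E.
Proof.
move=> f0 fg; have g0 x : (0 <= g x)%E by apply: le_trans (fg x).
rewrite !ge0_integralTE //; apply: le_ereal_sup => _ [h hf <-].
by exists h => // x; apply: le_trans (fg x).
Qed.

Lemma integral_step d (T : measurableType d) (R : realType)
    (mu : probability T R) (C : finType) (cell : T -> C) (psi : C -> R) :
    (forall c, measurable (cell @^-1` [set c])) -> (forall c, 0 <= psi c) ->
  (\int[mu]_x (psi (cell x))%:E =
   (\sum_c fine (mu (cell @^-1` [set c])) * psi c)%:E)%E.
Proof.
move=> mc psi0.
have -> : (fun x => (psi (cell x))%:E) =
    (fun x => \sum_c ((psi c)%:E * (\1_(cell @^-1` [set c]) x)%:E))%E.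
  apply/funext => x; rewrite (bigD1 (cell x)) //= big1 => [|c cx].
    by rewrite indicE mem_set //= mule1 adde0.
  by rewrite indicE memNset ?mule0 //= => e; rewrite e eqxx in cx.
rewrite ge0_integral_sum //; last 2 first.
- by move=> c; apply/measurable_EFinP; apply: measurable_funM => //; exact: measurable_indic.
- by move=> c x _; rewrite mule_ge0 // lee_fin.
rewrite -sumEFin; apply: eq_bigr => c _.
rewrite ge0_integralZl_EFin //; last by apply/measurable_EFinP; exact: measurable_indic.
rewrite integral_indic // setIT EFinM fineK ?fin_num_measure // muleC //.
Qed.

Section IterInt.
Variables (R : realType) (G : probability (measurableTypeR R * measurableTypeR R)%type R).

(** Nonnegativity is carried through the induction because comparing the outer integrals requires it
    of the inner ones. *)
Lemma iter_int_le k (h h' : seq (R * R) -> \bar R) :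
  (forall s, size s = k -> (0 <= h s)%E) -> (forall s, size s = k -> (h s <= h' s)%E) ->
  (0 <= iter_int G k h <= iter_int G k h')%E.
Proof.
elim: k h h' => [|k IH] h h' h0 hh' /=; first by rewrite h0 // hh'.
have H p : (0 <= iter_int G k (fun s => h (p :: s)) <=
              iter_int G k (fun s => h' (p :: s)))%E.
  by apply: IH => s sk; rewrite ?h0 ?hh' //= sk.
apply/andP; split; first by apply: integral_ge0 => p _; case/andP: (H p).
by apply: ge0_le_integral_nomeas => p; case/andP: (H p).
Qed.

Lemma iter_int_step (C : finType) (cell : R * R -> C) k (phi : seq C -> R) :
    (forall c, measurable (cell @^-1` [set c] : set (measurableTypeR R * measurableTypeR R))) ->
    (forall s, 0 <= phi s) ->
  iter_int G k (fun s => (phi (map cell s))%:E) =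
  (wsum (fun c => fine (G (cell @^-1` [set c]))) k phi)%:E.
Proof.
move=> mc; elim: k phi => [|k IH] phi phi0 //=.
under eq_integral do rewrite (IH (fun s => phi (cell _ :: s))) //.
rewrite (integral_step _ (psi := fun c => wsum _ k (fun s => phi (c :: s)))) // => c.
by apply: wsum_ge0 => // c'; rewrite fine_ge0.
Qed.
End IterInt.

(** * Grid masses of a permuton *)

(* [pattern_ind] with the comparisons of abscissae and ordinates abstracted. *)
Definition patt k (pi : 'S_k) (X Y : nat -> nat -> bool) : bool :=
  [exists p : 'S_k, [forall a : 'I_k, forall b : 'I_k,
     ((a < b)%N ==> X (p a) (p b)) && (Y (p a) (p b) == (pi a < pi b)%N)]].

Lemma eq_patt k (pi : 'S_k) (X Y X' Y' : nat -> nat -> bool) :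
    (forall i j, (i < k)%N -> (j < k)%N -> X i j = X' i j) ->
    (forall i j, (i < k)%N -> (j < k)%N -> Y i j = Y' i j) ->
  patt pi X Y = patt pi X' Y'.
Proof.
move=> eX eY; apply: eq_existsb => p; apply: eq_forallb => a; apply: eq_forallb => b.
by rewrite eX // eY.
Qed.

Section Cells.
Variable q : nat.
Let C : finType := ('I_q.+1 * 'I_q.+1)%type.

Definition cnth (s : seq C) i := nth (ord0, ord0) s i.

Definition cell_patt k (pi : 'S_k) (s : seq C) : bool :=
  patt pi (fun i j => (cnth s i).1 < (cnth s j).1)%N
          (fun i j => (cnth s i).2 < (cnth s j).2)%N.

Definition cell_gen (s : seq C) : bool := uniq (map fst s) && uniq (map snd s).

Lemma cell_gen_inj (s : seq C) i j : cell_gen s -> (i < size s)%N -> (j < size s)%N ->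
  ((cnth s i).1 = (cnth s j).1 -> i = j) /\ ((cnth s i).2 = (cnth s j).2 -> i = j).
Proof.
move=> /andP[u1 u2] si sj; split => e; apply/eqP.
  rewrite -(nth_uniq ord0 _ _ u1) ?size_map //.
  by rewrite !(nth_map (ord0, ord0)) //; apply/eqP.
rewrite -(nth_uniq ord0 _ _ u2) ?size_map //.
by rewrite !(nth_map (ord0, ord0)) //; apply/eqP.
Qed.

(** A monotone discretisation keeps strict comparisons of points it separates. The abstract form
    serves abscissae and ordinates of points as well as positions and values of a permutation. *)
Lemma cell_gen_lt (U : Type) (lt : U -> U -> bool) (f : U -> 'I_q.+1) (x y : U) :
    (forall x y, ~~ lt y x -> (f x <= f y)%N) -> (forall x y, lt x y -> ~~ lt y x) ->
    (f x = f y -> ~~ lt x y) ->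
  lt x y = (f x < f y)%N.
Proof.
move=> fh asym e; apply/idP/idP => [xy|]; last first.
  by apply: contraLR => /fh; rewrite -leqNgt.
rewrite ltn_neqAle fh ?asym // andbT; apply/eqP => /val_inj /e.
by rewrite xy.
Qed.

Lemma wsum_sum (R : comPzRingType) (D I : finType) (w : D -> R) k (F : I -> seq D -> R) :
  wsum w k (fun s => \sum_i F i s) = \sum_i wsum w k (F i).
Proof.
elim: k F => [|k IH] F //=.
under eq_bigr do rewrite IH mulr_sumr.
by rewrite exchange_big.
Qed.

(** Union bound over collisions: a new cell shares a row or a column with one of [k] earlier cells
    with weight at most [2 * k * eta], and [k ^ 2 + 2 * k <= k.+1 ^ 2]. In the proof, [psi c s]
    counts the collisions of [c] with [s]. *)
Lemma wsum_nongen (R : realDomainType) (w : C -> R) (eta : R) k :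
    (forall c, 0 <= w c) -> \sum_c w c = 1 ->
    (forall r, \sum_(c | c.1 == r) w c <= eta) ->
    (forall r, \sum_(c | c.2 == r) w c <= eta) ->
  wsum w k (fun s => (~~ cell_gen s)%:R) <= (k ^ 2)%:R * eta.
Proof.
move=> w0 w1 row col.
have eta0 : 0 <= eta by apply: le_trans (row ord0); apply: sumr_ge0.
elim: k => [|k IH]; first by rewrite /= mul0r.
pose psi (c : C) (s : seq C) : R :=
  \sum_(x <- s) ((c.1 == x.1)%:R + (c.2 == x.2)%:R).
apply: (@le_trans _ _ (wsum w k (fun s => (~~ cell_gen s)%:R) +
   wsum w k (fun s => \sum_c w c * psi c s))).
  set W := wsum w k _; have -> : W = \sum_c w c * W by rewrite -mulr_suml w1 mul1r.
  rewrite {}/W wsum_sum /= -big_split /=.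
  apply: ler_sum => c _; rewrite wsumZ -mulrDr -wsumD ler_wpM2l //.
  apply: wsum_le => // s _ /=.
  have psi0 : 0 <= psi c s by apply: sumr_ge0 => x _; rewrite addr_ge0.
  have [gs|] := boolP (cell_gen s); last first.
    by move=> _; rewrite ler_wpDr // ler_nat; case: (cell_gen (_ :: _)).
  rewrite add0r; have [//|ng] := boolP (cell_gen (c :: s)).
  have [x xs xc] : exists2 x, x \in s & (c.1 == x.1) || (c.2 == x.2).
    move: ng gs; rewrite /cell_gen /= => ng /andP[u1 u2]; move: ng.
    rewrite u1 u2 !andbT negb_and !negbK => /orP[] /mapP[x xs ->]; exists x => //.
      by rewrite eqxx.
    by rewrite eqxx orbT.
  rewrite /psi (big_rem x) //= ler_wpDr //.
    by apply: sumr_ge0 => y _; rewrite addr_ge0.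
  by rewrite -natrD ler_nat; case/orP: xc => ->; rewrite ?addn1.
apply: (@le_trans _ _ ((k ^ 2)%:R * eta + wsum w k (fun=> (2 * k)%:R * eta))).
  rewrite lerD //; apply: wsum_le => // s sk.
  rewrite /psi; under eq_bigr do rewrite mulr_sumr.
  rewrite exchange_big /= -sk.
  apply: (@le_trans _ _ (\sum_(x <- s) (eta + eta))).
    apply: ler_sum => x _; under eq_bigr do rewrite mulrDr.
    rewrite big_split /= lerD //.
      apply: le_trans (row x.1); rewrite [leRHS]big_mkcond /=.
      by apply: ler_sum => c _; case: eqP; rewrite ?mulr1 ?mulr0.
    apply: le_trans (col x.2); rewrite [leRHS]big_mkcond /=.
    by apply: ler_sum => c _; case: eqP; rewrite ?mulr1 ?mulr0.
  by rewrite big_const_seq count_predT iter_addr_0 -mulr2n -mulrnA mulr_natl.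
rewrite wsum_cst // -mulrDl ler_wpM2r // -natrD ler_nat; nia.
Qed.

Section Grid.
Variable R : realType.

(** The minimum puts [x = 1] into the last cell. The map is monotone on the whole line, so the two
    extreme cells are unbounded. *)
Definition grid_idx (x : R) : 'I_q.+1 := inord (minn (Num.truncn (x * q.+1%:R)) q).

Lemma grid_idxE x : grid_idx x = minn (Num.truncn (x * q.+1%:R)) q :> nat.
Proof. by rewrite inordK // ltnS geq_minr. Qed.

Lemma grid_idx_homo x y : x <= y -> (grid_idx x <= grid_idx y)%N.
Proof.
move=> xy; rewrite !grid_idxE leq_min geq_minr andbT (leq_trans (geq_minl _ _)) //.
by apply: le_truncn; rewrite ler_wpM2r.
Qed.

Lemma measurable_grid_idx (r : 'I_q.+1) :
  measurable (grid_idx @^-1` [set r] : set (measurableTypeR R)).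
Proof.
apply: is_interval_measurable => x y /= xr yr z /andP[xz zy]; apply/val_inj => /=.
apply/eqP; rewrite eqn_leq -{1}yr -xr !grid_idx_homo //.
Qed.

Lemma lebesgue_grid_idx (r : 'I_q.+1) :
  (lebesgue_measure ((grid_idx @^-1` [set r] : set R) `&` `[0%R, 1%R]) <= (q.+1%:R^-1)%:E)%E.
Proof.
have q0 : (0 : R) < q.+1%:R by rewrite ltr0n.
apply: (@le_trans _ _ (lebesgue_measure (`[(r%:R / q.+1%:R), (r.+1%:R / q.+1%:R)] : set R))).
  apply: le_measure; rewrite ?inE //.
    by apply: measurableI => //; exact: measurable_grid_idx.
  move=> x [/= xr]; rewrite !in_itv /= => /andP[x0 x1].
  have := grid_idxE x; rewrite xr => rE.
  have xq : 0 <= x * q.+1%:R by rewrite mulr_ge0.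
  rewrite ler_pdivrMr // ler_pdivlMr // rE; apply/andP; split.
    apply: (@le_trans _ _ (Num.truncn (x * q.+1%:R))%:R); first by rewrite ler_nat geq_minl.
    by rewrite truncn_le.
  have [tq|tq] := leqP (Num.truncn (x * q.+1%:R)) q.
    by apply/ltW; rewrite truncnS_gt.
  by rewrite -[leRHS]mul1r ler_wpM2r.
rewrite lebesgue_measure_itv /= lte_fin ltr_pM2r ?invr_gt0 // ltr_nat ltnSn.
by rewrite -EFinB -mulrBl -natrB // subSnn mul1r.
Qed.

Definition grid_cell (p : R * R) : C := (grid_idx p.1, grid_idx p.2).

Lemma measurable_grid_cell c :
  measurable (grid_cell @^-1` [set c] : set (measurableTypeR R * measurableTypeR R)).
Proof.
have -> : grid_cell @^-1` [set c] =
    (grid_idx @^-1` [set c.1]) `*` (grid_idx @^-1` [set c.2]).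
  case: c => c1 c2; apply/seteqP; split=> -[x y]; first by case=> <- <-.
  by case=> /= ex ey; rewrite /grid_cell /= ex ey.
by apply: measurableX; exact: measurable_grid_idx.
Qed.

Variable G : probability (measurableTypeR R * measurableTypeR R)%type R.
Hypothesis permG : permuton G.

Definition grid_mass (c : C) : R := fine (G (grid_cell @^-1` [set c])).

Lemma grid_mass_ge0 c : 0 <= grid_mass c.
Proof. by rewrite /grid_mass fine_ge0. Qed.

Lemma grid_mass_pred (P : pred C) :
  (\sum_(c | P c) grid_mass c)%:E = G (grid_cell @^-1` [set c | P c]).
Proof.
have -> : \sum_(c | P c) grid_mass c = \sum_c grid_mass c * (P c)%:R.
  by rewrite big_mkcond; apply: eq_bigr => c _; case: (P c); rewrite ?mulr1 ?mulr0.
rewrite -(integral_step _ (psi := fun c => (P c)%:R)) //; last exact: measurable_grid_cell.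
have mP : measurable (grid_cell @^-1` [set c | P c] :
    set (measurableTypeR R * measurableTypeR R)).
  have -> : grid_cell @^-1` [set c | P c] =
      \big[setU/set0]_(c | P c) (grid_cell @^-1` [set c]).
    apply/seteqP; split => x; rewrite -bigcup_seq_cond /=.
      by move=> Px; exists (grid_cell x) => //=; rewrite mem_index_enum.
    by case=> c /= /andP[_ Pc] xc; rewrite /mkset xc.
  by apply: bigsetU_measurable => c _; exact: measurable_grid_cell.
rewrite -[in RHS](setIT (grid_cell @^-1` _)) -(integral_indic _ measurableT mP).
apply: eq_integral => x _; rewrite indicE; congr (_%:R)%:E; congr nat_of_bool.
apply/idP/idP => [Px|]; first by rewrite mem_set.
by rewrite inE.
Qed.

Lemma grid_mass_sum : \sum_c grid_mass c = 1.
Proof.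
apply: EFin_inj; rewrite (grid_mass_pred predT) /=.
by rewrite (_ : _ @^-1` _ = setT) ?probability_setT //; apply/seteqP; split.
Qed.

Lemma grid_mass_row r : \sum_(c : C | c.1 == r) grid_mass c <= q.+1%:R^-1.
Proof.
rewrite -lee_fin grid_mass_pred; apply: le_trans (lebesgue_grid_idx r).
rewrite -(permG (measurable_grid_idx r)).1 le_eqVlt; apply/orP; left; apply/eqP.
by congr (G _); apply/seteqP; split => x /= /eqP.
Qed.

Lemma grid_mass_col r : \sum_(c : C | c.2 == r) grid_mass c <= q.+1%:R^-1.
Proof.
rewrite -lee_fin grid_mass_pred; apply: le_trans (lebesgue_grid_idx r).
rewrite -(permG (measurable_grid_idx r)).2 le_eqVlt; apply/orP; left; apply/eqP.
by congr (G _); apply/seteqP; split => x /= /eqP.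
Qed.

Definition gen_patt k (pi : 'S_k) (s : seq C) : R := (cell_gen s && cell_patt pi s)%:R.
Definition nongen (s : seq C) : R := (~~ cell_gen s)%:R.

Lemma pattern_ind_grid k (pi : 'S_k) (s : seq (R * R)) :
    size s = k -> cell_gen (map grid_cell s) ->
  pattern_ind pi s = (cell_patt pi (map grid_cell s))%:R%:E.
Proof.
move=> sk gs; rewrite /pattern_ind -/(patt pi
  (fun i j => (nth (0, 0) s i).1 < (nth (0, 0) s j).1)
  (fun i j => (nth (0, 0) s i).2 < (nth (0, 0) s j).2)).
have E i : (i < k)%N -> cnth (map grid_cell s) i = grid_cell (nth (0, 0) s i).
  by move=> ik; rewrite /cnth (nth_map (0, 0)) // sk.
congr (_%:R)%:E; congr nat_of_bool; apply: eq_patt => i j ik jk; rewrite !E //.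
- apply: (@cell_gen_lt R <%R grid_idx) => [x y|x y|e]; rewrite -?leNgt.
  + exact: grid_idx_homo.
  + exact: ltW.
  + have [] := @cell_gen_inj _ i j gs; rewrite ?size_map ?sk // !E // => /(_ e) -> _ //.
- apply: (@cell_gen_lt R <%R grid_idx) => [x y|x y|e]; rewrite -?leNgt.
  + exact: grid_idx_homo.
  + exact: ltW.
  + have [] := @cell_gen_inj _ i j gs; rewrite ?size_map ?sk // !E // => _ /(_ e) -> //.
Qed.

(** On generic words the cells decide the pattern; on the others the indicator is only known to lie
    between 0 and 1. Both bounds are iterated integrals of step functions, hence finite sums, which
    also makes the integral finite. *)
Lemma rho_permuton_grid k (pi : 'S_k) :
  wsum grid_mass k (gen_patt pi) <= rho_permuton G (existT _ k pi) <=
  wsum grid_mass k (gen_patt pi) + wsum grid_mass k nongen.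
Proof.
have p0 s : (0 <= pattern_ind pi s :> \bar R)%E by rewrite /pattern_ind lee_fin.
have p1 s : (pattern_ind pi s <= 1%:E :> \bar R)%E.
  by rewrite /pattern_ind lee_fin; case: [exists _, _].
have lo : ((wsum grid_mass k (gen_patt pi))%:E <= iter_int G k (pattern_ind pi))%E.
  rewrite -iter_int_step; [|exact: measurable_grid_cell|by move=> s; rewrite /gen_patt].
  apply: (proj2 (andP (iter_int_le _ _ _))) => s sk; first by rewrite lee_fin.
  rewrite /gen_patt; have [gs|] //= := boolP (cell_gen _).
  by rewrite pattern_ind_grid.
have hi : (iter_int G k (pattern_ind pi) <=
    (wsum grid_mass k (fun s => gen_patt pi s + nongen s)%R)%:E)%E.
  rewrite -iter_int_step; [|exact: measurable_grid_cell|]; last first.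
    by move=> s; rewrite /gen_patt /nongen addr_ge0.
  apply: (proj2 (andP (iter_int_le _ _ _))) => s sk; first exact: p0.
  rewrite /gen_patt /nongen; have [gs|] //= := boolP (cell_gen _); last by rewrite add0r.
  by rewrite pattern_ind_grid // addr0.
rewrite -wsumD /rho_permuton /=.
have fin : iter_int G k (pattern_ind pi) \is a fin_num.
  by rewrite fin_numE; apply/andP; split; apply/eqP => e; move: lo hi; rewrite e.
by rewrite -!lee_fin fineK // lo hi.
Qed.
End Grid.
End Cells.

(** * Permutations with prescribed cell counts *)

(** An increasing permutation moves no point down, and neither does its inverse. *)
Lemma incr_perm_id k (s : 'S_k) : (forall a b : 'I_k, (a < b)%N -> (s a < s b)%N) ->
  s = 1%g.
Proof.
have ge (t : 'S_k) : (forall a b : 'I_k, (a < b)%N -> (t a < t b)%N) ->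
    forall a : 'I_k, (a <= t a)%N.
  move=> ti [m mk]; elim: m mk => // m IH mk /=.
  by apply: leq_ltn_trans (IH (ltnW mk)) _; apply: ti.
move=> si; apply/permP => a; rewrite perm1; apply/val_inj/eqP; rewrite /= eqn_leq ge // andbT.
have siV : forall a b : 'I_k, (a < b)%N -> (s^-1%g a < s^-1%g b)%N.
  move=> x y xy; have [|/si|/val_inj/perm_inj e] // := ltngtP (s^-1%g x) (s^-1%g y).
    by rewrite !permKV ltnNge ltnW.
  by rewrite e ltnn in xy.
by have := ge _ siV (s a); rewrite permK.
Qed.

(** The witness in [patt] sorts the entries by position; since [g] increases, it can only be
    [p^-1]. *)
Lemma patt_occ k N (pi : 'S_k) (gam : 'S_N) (g : {ffun 'I_k -> 'I_N}) (p : 'S_k)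
    (t : seq 'I_N) (x0 : 'I_N) :
    incr g -> (forall i : 'I_k, nth x0 t i = g (p i)) ->
  patt pi (fun i j => nth x0 t i < nth x0 t j)%N
          (fun i j => gam (nth x0 t i) < gam (nth x0 t j))%N = occ pi gam g.
Proof.
move=> gi tE; apply/existsP/idP => [[p' /forallP h]|oc].
  have pp : (p' * p)%g = 1%g.
    apply: incr_perm_id => a b ab.
    have /forallP/(_ b)/andP[/implyP/(_ ab)] := h a.
    rewrite !tE => gab _; rewrite !permM ltnNge; apply: contraL gab => ba.
    by rewrite -leqNgt incr_leq.
  apply/forallP => a; apply/forallP => b.
  have /forallP/(_ b)/andP[_] := h a; rewrite !tE.
  by move/permP: pp => pp; have := pp a; have := pp b; rewrite !permM !perm1 => -> ->.
exists p^-1%g; apply/forallP => a; apply/forallP => b; rewrite !tE !permKV.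
by have /forallP/(_ b) -> := forallP oc a; rewrite andbT; apply/implyP => /(incrP g gi).
Qed.

(** Sorting writes a duplicate-free tuple as a rearrangement of an increasing one, and there are
    [k!] rearrangements. *)
Lemma card_tuple_incr k N (A : pred (k.-tuple 'I_N)) (B : pred {ffun 'I_k -> 'I_N}) :
    (forall t, A t -> uniq t) ->
    (forall (g : {ffun 'I_k -> 'I_N}) (p : 'S_k), incr g -> A [tuple g (p i) | i < k] -> B g) ->
  (#|A| <= #|[pred g | incr g && B g]| * k`!)%N.
Proof.
move=> Au AB.
pose P := [pred x : {ffun 'I_k -> 'I_N} * 'S_k | incr x.1 && B x.1].
have -> : (#|[pred g | incr g && B g]| * k`!)%N = #|P|.
  by rewrite -card_Sn -cardX; apply: eq_card => x; rewrite !inE andbT.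
pose f (x : {ffun 'I_k -> 'I_N} * 'S_k) := [tuple x.1 (x.2 i) | i < k].
apply: (@leq_trans #|[seq f x | x in P]|); last exact: leq_image_card.
apply/subset_leq_card/fintype.subsetP => t tA.
pose leT (x y : 'I_N) := (x <= y)%N.
have st : size (sort leT t) == k by rewrite size_sort size_tuple.
have /tuple_permP[p tp] : perm_eq t (Tuple st) by rewrite perm_sym perm_sort.
pose g : {ffun 'I_k -> 'I_N} := [ffun i => tnth (Tuple st) i].
have tE : t = f (g, p).
  by apply/val_inj; rewrite /= tp; apply/eq_map => i; rewrite ffunE.
have gi : incr g.
  apply/incrP => a b ab; have x0 : 'I_N := g a.
  rewrite !ffunE !(tnth_nth x0) /=.
  have sz (i : 'I_k) : (i < size (sort leT t))%N by rewrite (eqP st).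
  rewrite ltn_neqAle; apply/andP; split.
    apply/eqP => /val_inj/eqP; rewrite nth_uniq //; first by rewrite ltn_eqF.
    by rewrite sort_uniq Au.
  have leT_tr : transitive leT by move=> y x z; apply: leq_trans.
  have leT_refl : reflexive leT by move=> x; apply: leqnn.
  apply: (sorted_leq_nth leT_tr leT_refl); rewrite ?inE ?sz 1?ltnW //.
  by apply: sort_sorted => x y; apply: leq_total.
apply/mapP; exists (g, p) => //; rewrite mem_enum inE /= gi /=.
by apply: (AB g p gi); rewrite -/(f (g, p)) -tE.
Qed.

Lemma sum_tupleS (R : nmodType) (T : finType) k (F : k.+1.-tuple T -> R) :
  \sum_(t : k.+1.-tuple T) F t = \sum_(x : T) \sum_(t : k.-tuple T) F (cons_tuple x t).
Proof.
rewrite pair_big /= (reindex (fun x : T * k.-tuple T => cons_tuple x.1 x.2)) //=.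
exists (fun t => (thead t, behead_tuple t)) => [[x t] _|t _] /=.
  by congr (_, _); apply/val_inj.
by case/tupleP: t => x t; apply/val_inj.
Qed.

Lemma card_tuple_wsum (R : comPzRingType) (T C : finType) (cell : T -> C) k (phi : seq C -> bool) :
  (#|[pred t : k.-tuple T | phi (map cell t)]|)%:R =
  wsum (fun c => (#|[pred x | cell x == c]|)%:R : R) k (fun s => (phi s)%:R).
Proof.
have -> : (#|[pred t : k.-tuple T | phi (map cell t)]|)%:R =
    \sum_(t : k.-tuple T) (phi (map cell t))%:R :> R.
  by rewrite -sum1_card natr_sum big_mkcond; apply: eq_bigr => t _; rewrite inE; case: (phi _).
elim: k phi => [|k IH] phi.
  by rewrite (big_pred1 [tuple]) // => t; apply/esym/eqP; exact: tuple0.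
rewrite sum_tupleS (partition_big cell predT) //=; apply: eq_bigr => c _.
rewrite -IH (eq_bigr (fun=> \sum_(t : k.-tuple T) (phi (c :: map cell t))%:R)).
  by rewrite sumr_const mulr_natl; congr (_ *+ _); apply: eq_card => x; rewrite !inE.
by move=> x /eqP <-.
Qed.

Section Counts.
Variable q : nat.
Let C : finType := ('I_q.+1 * 'I_q.+1)%type.

(** List every cell with its multiplicity, once sorted by first coordinate and once by second. The
    two lists are rearrangements of each other, and a permutation matching them sends positions to
    values. *)
Lemma perm_of_counts (cnt : C -> nat) :
  exists (N : nat) (gam : 'S_N) (cell : 'I_N -> C),
    [/\ forall x y : 'I_N, (x <= y)%N -> ((cell x).1 <= (cell y).1)%N,
        forall x y : 'I_N, (gam x <= gam y)%N -> ((cell x).2 <= (cell y).2)%N &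
        forall c, #|[pred x | cell x == c]| = cnt c].
Proof.
pose s0 := flatten [seq nseq (cnt c) c | c <- enum C].
pose row (c d : C) := (c.1 <= d.1)%N; pose col (c d : C) := (c.2 <= d.2)%N.
have s1P : size (sort row s0) == size s0 by rewrite size_sort.
have s2P : size (sort col s0) == size s0 by rewrite size_sort.
have /tuple_permP[p s12] : perm_eq (Tuple s1P) (Tuple s2P).
  by rewrite /= perm_sort perm_sym perm_sort.
have cellE x : tnth (Tuple s1P) x = tnth (Tuple s2P) (p x).
  by rewrite -[in RHS](tnth_mktuple (fun i => tnth (Tuple s2P) (p i))) !(tnth_nth (ord0, ord0)) s12.
have row_tr : transitive row by move=> y x z; apply: leq_trans.
have row_refl : reflexive row by move=> x; apply: leqnn.
have col_tr : transitive col by move=> y x z; apply: leq_trans.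
have col_refl : reflexive col by move=> x; apply: leqnn.
exists (size s0), p, (tnth (Tuple s1P)); split.
- move=> x y xy; rewrite !(tnth_nth (ord0, ord0)) -[(_ <= _)%N]/(row _ _).
  apply: (sorted_leq_nth row_tr row_refl); rewrite ?inE ?(eqP s1P) //.
  by apply: sort_sorted => c d; apply: leq_total.
- move=> x y xy; rewrite !cellE !(tnth_nth (ord0, ord0)) -[(_ <= _)%N]/(col _ _).
  apply: (sorted_leq_nth col_tr col_refl); rewrite ?inE ?(eqP s2P) //.
  by apply: sort_sorted => c d; apply: leq_total.
move=> c; transitivity (count_mem c (Tuple s1P)).
  rewrite -[X in count_mem c X]map_tnth_enum count_map enumT cardE /enum_mem size_filter.
  by apply: eq_count => x; rewrite !inE.
rewrite /= count_sort count_flatten -map_comp sumnE big_map big_enum /=.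
rewrite (bigD1 c) //= count_nseq /= eqxx mul1n big1 ?addn0 // => d dc.
by rewrite count_nseq /= (negbTE dc) mul0n.
Qed.

Section Density.
Variables (R : realType) (N : nat) (gam : 'S_N) (cell : 'I_N -> C).
Hypothesis N0 : (0 < N)%N.
Hypothesis cell1 : forall x y : 'I_N, (x <= y)%N -> ((cell x).1 <= (cell y).1)%N.
Hypothesis cell2 : forall x y : 'I_N, (gam x <= gam y)%N -> ((cell x).2 <= (cell y).2)%N.

Definition cell_freq (c : C) : R := N%:R^-1 * (#|[pred x | cell x == c]|)%:R.

Lemma cell_patt_occ k (pi : 'S_k) (g : {ffun 'I_k -> 'I_N}) (p : 'S_k) :
    incr g -> cell_gen (map cell [tuple g (p i) | i < k]) ->
  cell_patt pi (map cell [tuple g (p i) | i < k]) = occ pi gam g.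
Proof.
move=> gi; set t := [tuple _ | _ < _] => gen.
pose x0 := Ordinal N0.
have st : size t = k by rewrite size_tuple.
have E i : (i < k)%N -> cnth (map cell t) i = cell (nth x0 t i).
  by move=> ik; rewrite /cnth (nth_map x0) // st.
have sz i : (i < k)%N -> (i < size (map cell t))%N by rewrite size_map st.
have tE (i : 'I_k) : nth x0 t i = g (p i) by rewrite -tnth_nth tnth_mktuple.
rewrite -(patt_occ pi gam gi tE); apply: eq_patt => i j ik jk;
  have [] := cell_gen_inj gen (sz i ik) (sz j jk); rewrite !E // => i1 i2; apply/esym.
- apply: (@cell_gen_lt _ 'I_N (fun x y => x < y)%N (fst \o cell)) => [x y|x y xy|e].
  + by rewrite -leqNgt; apply: cell1.
  + by rewrite -leqNgt ltnW.
  + by rewrite (i1 e) ltnn.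
- apply: (@cell_gen_lt _ 'I_N (fun x y => gam x < gam y)%N (snd \o cell)) => [x y|x y xy|e].
  + by rewrite -leqNgt; apply: cell2.
  + by rewrite -leqNgt ltnW.
  + by rewrite (i2 e) ltnn.
Qed.

(** The left side is a count of tuples over [N ^ k]. Generic words come from duplicate-free tuples,
    each window accounts for at most [k!] of them, and [N ^ k] is at least [k!] times the number of
    windows. *)
Lemma cell_freq_bound k (phi : seq C -> bool) (B : pred {ffun 'I_k -> 'I_N}) :
    (k <= N)%N -> (forall s, phi s -> cell_gen s) ->
    (forall (g : {ffun 'I_k -> 'I_N}) (p : 'S_k), incr g ->
       phi (map cell [tuple g (p i) | i < k]) -> B g) ->
  wsum cell_freq k (fun s => (phi s)%:R) <=
  (#|[pred g : {ffun 'I_k -> 'I_N} | incr g && (width g <= N)%N && B g]|)%:R / (nwin k N N)%:R.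
Proof.
move=> kN gen HB.
rewrite /cell_freq wsum_scale -card_tuple_wsum nwin_full //.
set A := [pred t | _].
have cA : (#|A| <= #|[pred g : {ffun 'I_k -> 'I_N} | incr g &&
    ((width g <= N)%N && B g)]| * k`!)%N.
  apply: card_tuple_incr => [t /gen /andP[/map_uniq/map_uniq //]|g p gi At].
  rewrite (HB g p) // andbT; apply/widthP => // a b.
  exact: leq_ltn_trans (leq_subr _ _) (ltn_ord _).
set Y := #|[pred g | _ && B g]|.
have {}cA : (#|A| <= Y * k`!)%N.
  by rewrite (leq_trans cA) // leq_mul2r; apply/orP; right; apply/eq_leq/eq_card => g; rewrite !inE andbA.
have bN : (0 : R) < ('C(N, k))%:R by rewrite ltr0n bin_gt0.
have Nk : (0 : R) < N%:R ^+ k by rewrite exprn_gt0 // ltr0n.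
rewrite exprVn ler_pdivlMr // -mulrA mulrC ler_pdivrMr // -natrX -!natrM ler_nat.
apply: leq_trans (leq_mul cA (leqnn _)) _.
by rewrite -mulnA leq_mul2l [(k`! * _)%N]mulnC bin_ffact ffact_leX orbT.
Qed.

Lemma cell_freq_sum : \sum_c cell_freq c = 1.
Proof.
rewrite -mulr_sumr -natr_sum -[X in _ * X%:R](_ : N = _) ?mulVf ?pnatr_eq0 ?gt_eqF //.
rewrite -[LHS]card_ord -sum1_card (partition_big cell predT) //=.
by apply: eq_bigr => c _; rewrite -sum1_card; apply: eq_bigl => x; rewrite !inE.
Qed.

(** The finite analogue of [rho_permuton_grid]; the upper bound is [cell_freq_bound] applied to
    non-occurrences. *)
Lemma rho_cells k (pi : 'S_k) : (k <= N)%N ->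
  wsum cell_freq k (gen_patt R pi) <= rho (N%:R : R) pi gam <=
  wsum cell_freq k (gen_patt R pi) + wsum cell_freq k (nongen R (q := q)).
Proof.
move=> kN; rewrite rho_natE; apply/andP; split.
  apply: cell_freq_bound => // [s /andP[] //|g p gi /andP[gen]].
  by rewrite cell_patt_occ.
have w0 : (0 : R) < (nwin k N N)%:R by rewrite ltr0n nwin_full // bin_gt0.
have : wsum cell_freq k (fun s => (cell_gen s && ~~ cell_patt pi s)%:R) <=
    1 - (nocc N pi gam)%:R / (nwin k N N)%:R.
  rewrite -{2}(divff (lt0r_neq0 w0)) -mulrBl -natrB ?nocc_le // nocc_compl.
  apply: cell_freq_bound => // [s /andP[] //|g p gi /andP[gen]].
  by rewrite cell_patt_occ.
rewrite lerBrDr addrC -lerBrDr => /le_trans; apply.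
rewrite lerBlDr -!wsumD -[leLHS](@wsum_cst _ _ cell_freq k 1) ?cell_freq_sum //.
rewrite le_eqVlt; apply/orP; left; apply/eqP; apply: eq_wsum => s _.
by rewrite /gen_patt /nongen; case: (cell_gen s); case: (cell_patt pi s);
  rewrite /= ?addr0 ?add0r.
Qed.
End Density.
End Counts.

(** * Approximation of a permuton by finite permutations *)

Lemma cvg_truncn_div (R : realType) (a : R) : 0 <= a ->
  (Num.truncn (m%:R * a))%:R / m%:R @[m --> \oo] --> a.
Proof.
move=> a0; apply: (@squeeze_cvgr _ _ _ _ (fun m : nat => a - m%:R^-1) (fun=> a)).
- near=> m.
  have m0 : (0 : R) < m%:R by rewrite ltr0n; near: m; exact: nbhs_infty_gt.
  have ma : 0 <= m%:R * a by rewrite mulr_ge0.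
  have /andP[t1 t2] := truncn_itv ma.
  apply/andP; split; last by rewrite ler_pdivrMr // [leRHS]mulrC.
  by rewrite ler_pdivlMr // mulrBl mulVf ?gt_eqF // lerBlDr [(a * _)%R]mulrC natr1 ltW.
- rewrite -[X in _ --> X]subr0; apply: cvgB; first exact: cvg_cst.
  by rewrite -cvg_shiftS; exact: cvg_harmonic.
- exact: cvg_cst.
Unshelve. all: by end_near.
Qed.

Lemma permuton_approx (R : realType)
    (G : probability (measurableTypeR R * measurableTypeR R)%type R) (K M : nat) (eps : R) :
    permuton G -> 0 < eps ->
  exists (N : nat) (gam : 'S_N), (M <= N)%N /\
    forall k (pi : 'S_k), (k <= K)%N ->
      `|rho (N%:R : R) pi gam - rho_permuton G (existT _ k pi)| < eps.
Proof.
move=> pG eps0.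
have e4 : 0 < eps / 4 by rewrite divr_gt0.
(* Rows and columns have mass at most [1 / q.+1], so this grid gives non-generic words a weight of
   at most [eps / 4]. *)
have [q hq] : exists q : nat, (K ^ 2)%:R / q.+1%:R <= eps / 4.
  exists (Num.truncn ((K ^ 2)%:R / (eps / 4))).
  rewrite ler_pdivrMr ?ltr0n // mulrC -ler_pdivrMr //.
  exact/ltW/truncnS_gt.
pose w := @grid_mass q R G.
have w0 c : 0 <= w c := grid_mass_ge0 G c.
have w1 : \sum_c w c = 1 := grid_mass_sum q G.
have nong k : (k <= K)%N -> wsum w k (nongen R (q := q)) <= eps / 4.
  move=> kK; apply: le_trans hq.
  apply: le_trans (wsum_nongen k w0 w1 (grid_mass_row pG) (grid_mass_col pG)) _.
  by rewrite ler_wpM2r ?invr_ge0 // ler_nat leq_sqr.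
(* These counts have frequencies tending to the masses, although their total [Nm m] is only
   asymptotic to [m]. *)
pose cnt m c := Num.truncn (m%:R * w c).
pose Nm m := (\sum_c cnt m c)%N.
pose fr m c : R := (Nm m)%:R^-1 * (cnt m c)%:R.
have cvgN : (Nm m)%:R / m%:R @[m --> \oo] --> (1 : R).
  have -> : (fun m => (Nm m)%:R / m%:R : R) = (fun m => \sum_c (cnt m c)%:R / m%:R).
    by apply/funext => m; rewrite /Nm natr_sum mulr_suml.
  rewrite -[X in _ --> X]w1.
  by apply: cvg_big => [|c _]; [exact: add_continuous|exact: cvg_truncn_div].
have cvgf c : fr m c @[m --> \oo] --> w c.
  rewrite [X in _ --> X](_ : _ = 1^-1 * w c); last by rewrite invr1 mul1r.
  apply: (@cvg_trans _ (((Nm m)%:R / m%:R)^-1 * ((cnt m c)%:R / m%:R) @[m --> \oo])).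
    apply: near_eq_cvg; near=> m.
    have m0 : m%:R != 0 :> R.
      by rewrite pnatr_eq0 -lt0n; near: m; exact: nbhs_infty_gt.
    by rewrite /fr invfM invrK mulrACA divff // mulr1.
  apply: cvgM; last exact: cvg_truncn_div.
  by apply: cvgV => //; exact: oner_neq0.
have Nbig : \forall m \near \oo, (maxn (maxn M K) 1 <= Nm m)%N.
  near=> m.
  have m0 : (0 : R) < m%:R by rewrite ltr0n; near: m; exact: nbhs_infty_gt.
  have h : 1 / 2 < (Nm m)%:R / m%:R :> R.
    by near: m; apply: (cvgr_gt (1 : R)) => //; lra.
  rewrite -(ler_nat R); apply/ltW; apply: le_lt_trans (_ : _ <= m%:R / 2) _.
    rewrite ler_pdivlMr // -natrM ler_nat; near: m; exact: nbhs_infty_ge.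
  by move: h; rewrite ltr_pdivlMr // mulrC mul1r.
have lowc : \forall m \near \oo, forall (k : 'I_K.+1) (pi : 'S_k),
    `|wsum (fr m) k (gen_patt R (q := q) pi) - wsum w k (gen_patt R pi)| < eps / 4.
  apply: filter_forall => k; apply: filter_forall => pi.
  have /cvgrPdist_lt/(_ _ e4) := cvg_wsum (k := k) (phi := gen_patt R (q := q) pi) cvgf.
  by apply: filterS => m; rewrite distrC.
have nonc : \forall m \near \oo, forall (k : 'I_K.+1),
    `|wsum (fr m) k (nongen R (q := q)) - wsum w k (nongen R (q := q))| < eps / 4.
  apply: filter_forall => k.
  have /cvgrPdist_lt/(_ _ e4) := cvg_wsum (k := k) (phi := nongen R (q := q)) cvgf.
  by apply: filterS => m; rewrite distrC.
have [m [[hN hl] hn]] := filter_ex (filterI (filterI Nbig lowc) nonc).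
have [N [gam [cell [c1 c2 cE]]]] := perm_of_counts (cnt m).
have NE : N = Nm m.
  rewrite -[LHS]card_ord -sum1_card (partition_big cell predT) //=.
  apply: eq_bigr => c _; rewrite -cE -sum1_card; apply: eq_bigl => x; rewrite !inE //.
have frE : cell_freq R cell = fr m.
  by apply/funext => c; rewrite /cell_freq /fr cE NE.
move: hN; rewrite -NE !geq_max => /andP[/andP[MN KN] N0].
exists N, gam; split=> // k pi kK.
have kK' : (k < K.+1)%N by [].
have /andP[r1 r2] := rho_cells R N0 c1 c2 pi (leq_trans kK KN).
have /andP[g1 g2] := rho_permuton_grid q G pi.
have := hl (Ordinal kK') pi; have := hn (Ordinal kK'); have := nong k kK.
rewrite /= -frE !ltr_norml => n1 /andP[n2 n3] /andP[n4 n5].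
move: r1 r2 g1 g2 n1 n2 n3 n4 n5; rewrite -/w.
(* The two lower bounds differ by less than [eps / 4], and the sandwiches have lengths below
   [eps / 2] and at most [eps / 4]: in all less than [eps]. *)
set a := wsum _ _ _; set b := wsum _ _ _; set c := wsum _ _ _; set d := wsum _ _ _.
move: (rho _ _ _) (rho_permuton _ _) => x y.
by move=> *; apply/andP; split; lra.
Unshelve. all: by end_near.
Qed.

(** * Layers *)

Section Layers.
Variables (R : realType) (K : nat) (eps d : R).
Hypotheses (eps0 : 0 < eps) (d0 : 0 < d) (d1 : 2 * d <= 1).

Let d_lt1 : d < 1. Proof. by have := d1; have := d0; lra. Qed.

(** A finite witness of [Xi]: the window width [w] is large against the pattern size and small
    against [s], as [scale_density] requires. *)
Definition scale_source (Xi : AnyPerm -> R) s (sigma : 'S_s) (w : nat) : Prop :=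
  [/\ (1 < w < s)%N, K%:R <= d * w%:R, w%:R <= d * s%:R &
      forall k (pi : 'S_k), (k <= K)%N ->
        `|rho (w%:R : R) pi sigma - Xi (existT _ k pi)| < eps].

Definition local_source (L : AnyPerm -> R) s (sigma : 'S_s) : Prop :=
  [/\ (K < s)%N, K%:R <= d * s%:R &
      forall k (pi : 'S_k), (k <= K)%N ->
        `|rho (k%:R : R) pi sigma - L (existT _ k pi)| < eps].

Lemma size_to_infty_near (u : nat -> AnyPerm) (P : nat -> Prop) :
    size_to_infty u -> (\forall n \near \oo, P n) ->
  \forall j \near \oo, P (psize (u j)).
Proof.
move=> us [N _ NP]; have [J JP] := us N; exists J => // j Jj; apply: NP; exact: JP.
Qed.

Lemma near_patterns (v : nat -> AnyPerm -> R) (L : AnyPerm -> R) :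
    (forall pi, v j pi @[j --> \oo] --> L pi) ->
  \forall j \near \oo, forall k (pi : 'S_k), (k <= K)%N ->
    `|v j (existT _ k pi) - L (existT _ k pi)| < eps.
Proof.
move=> vL.
have : \forall j \near \oo, forall (k : 'I_K.+1) (pi : 'S_k),
    `|v j (existT _ (k : nat) pi) - L (existT _ (k : nat) pi)| < eps.
  apply: filter_forall => k; apply: filter_forall => pi.
  have /cvgrPdist_lt/(_ _ eps0) := vL (existT _ (k : nat) pi).
  by apply: filterS => j; rewrite distrC.
by apply: filterS => j h k pi kK; exact: (h (Ordinal (kK : (k < K.+1)%N)) pi).
Qed.

Lemma nat_le_scale (a : nat) : \forall n \near \oo, a%:R <= d * n%:R.
Proof.
near=> n; rewrite mulrC -ler_pdivrMr //.
apply: ltW; apply: lt_le_trans (truncnS_gt _) _; rewrite ler_nat.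
by near: n; exact: nbhs_infty_gt.
Unshelve. all: by end_near.
Qed.

Lemma local_sourceP (L : AnyPerm -> R) : local_limit L ->
  exists s (sigma : 'S_s), local_source L sigma.
Proof.
move=> [u [us uL]].
have h1 := size_to_infty_near us (nat_le_scale K).
have h2 := size_to_infty_near us (nbhs_infty_gt K).
have [j [[j1 j2] j3]] := filter_ex (filterI (filterI h1 h2) (near_patterns uL)).
by exists (psize (u j)), (projT2 (u j)); split.
Qed.

Lemma scale_sourceP (Xi : AnyPerm -> R) : scale_limit Xi ->
  exists s (sigma : 'S_s) w, scale_source Xi sigma w.
Proof.
move=> [f [u [[fpos [finf flin]] [us uX]]]].
(* The 2 gives [1 < w] for the truncation [w] of [f n], and the added 1 makes up for truncating in
   [K <= d * w]. *)
have h1 : \forall n \near \oo, Num.max 2 (K%:R / d + 1) < f n.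
  by have [N NP] := finf (Num.max 2 (K%:R / d + 1)); exists N.
have h2 : \forall n \near \oo, `|f n / n%:R| < d.
  have /cvgrPdist_lt/(_ _ d0) := flin.
  by apply: filterS => n; rewrite sub0r normrN.
have h123 : \forall n \near \oo,
    (Num.max 2 (K%:R / d + 1) < f n /\ `|f n / n%:R| < d) /\ (0 < n)%N.
  by apply: filterI; [apply: filterI|exact: nbhs_infty_gt].
have h3 := size_to_infty_near us h123.
have [j [[[j1 j2] j0] j3]] := filter_ex (filterI h3 (near_patterns uX)).
set n := psize (u j) in j1 j2 j0.
have n0 : (0 : R) < n%:R by rewrite ltr0n.
have [fn0 _] := fpos n j0.
have /andP[t1 t2] := truncn_itv (ltW fn0).
have fd : f n < d * n%:R.
  by move: j2; rewrite ger0_norm ?ltr_pdivrMr // divr_ge0 // ltW.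
move: j1; rewrite gt_max => /andP[f2 fK].
exists n, (projT2 (u j)), (Num.truncn (f n)); split.
- apply/andP; split; first by rewrite truncn_gt_nat ltW.
  rewrite -(ltr_nat R); apply: le_lt_trans t1 _; apply: lt_trans fd _.
  by rewrite gtr_pMl // d_lt1.
- rewrite mulrC -ler_pdivrMr //.
  by move: t2 fK; rewrite -natr1; lra.
- by apply: le_trans t1 (ltW fd).
- by move=> k pi kK; rewrite -rho_truncn; exact: j3.
Qed.

(** [Q] is the length of a prefix cut into whole frames; lifted windows have width at most [b * w],
    which fits [phi] up to a factor [1 - d]. *)
Definition scale_layer Q n (phi : R) (Xi : AnyPerm -> R) (tau : 'S_n) : Prop :=
  exists s (sigma : 'S_s) w b, scale_source Xi sigma w /\
    [/\ (0 < b)%N, (b * s %| Q)%N, (b * w)%:R <= phi, (1 - d) * phi <= (b * w)%:R &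
        blockwise Q b sigma tau].

Definition local_layer Q n (L : AnyPerm -> R) (tau : 'S_n) : Prop :=
  exists s (sigma : 'S_s), local_source L sigma /\ (s %| Q)%N /\ blockwise Q 1 sigma tau.

(** A layer of [rho] survives in any permutation made of consecutive copies of [rho], so later
    inflations keep earlier scales. *)
Lemma scale_layer_trans Q n r phi Xi (rho : 'S_r) (tau : 'S_n) :
    (0 < r)%N -> (r %| Q)%N -> blockwise Q 1 rho tau ->
  scale_layer r phi Xi rho -> scale_layer Q phi Xi tau.
Proof.
move=> r0 rQ bw [s [sigma [w [b [src [b0 bs l1 l2 bw']]]]]].
exists s, sigma, w, b; split=> //; split => //; first exact: dvdn_trans rQ.
rewrite -[b]mul1n; apply: blockwise_trans bw' => //.
by case: src => /andP[_ ws] _ _ _; exact: leq_ltn_trans ws.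
Qed.

Lemma local_layer_trans Q n r L (rho : 'S_r) (tau : 'S_n) :
    (0 < r)%N -> (r %| Q)%N -> blockwise Q 1 rho tau ->
  local_layer r L rho -> local_layer Q L tau.
Proof.
move=> r0 rQ bw [s [sigma [src [sr bw']]]].
exists s, sigma; split=> //; split; first exact: dvdn_trans rQ.
rewrite -[1%N]mul1n; apply: blockwise_trans bw' => //; last by rewrite mul1n.
by case: src => Ks _ _; exact: leq_ltn_trans Ks.
Qed.

Lemma scale_layer_rho Q n phi Xi (tau : 'S_n) k (pi : 'S_k) :
    (0 < Q <= n)%N -> (1 - d) * n%:R <= Q%:R -> (k <= K)%N ->
    scale_layer Q phi Xi tau ->
  `|rho phi pi tau - Xi (existT _ k pi)| < eps + k.+1%:R * (2 * d).
Proof.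
have [d0' d1' d_lt1'] := And3 d0 d1 d_lt1.
move=> /andP[Q0 Qn] hQ kK [s [sigma [w [b [[/andP[w1 ws] Kw wd src] [b0 bs l1 l2 bw]]]]]].
(* The loss is doubled: [b * w] falls short of [phi] by a factor [1 - d], and removing [k] from [w]
   costs another. *)
have d01 : 0 <= 2 * d <= 1 by rewrite d1 mulr_ge0 // ltW.
have w0 : (0 : R) < w%:R by rewrite ltr0n ltnW.
have kw : (k <= w)%N.
  rewrite (leq_trans kK) // -(ler_nat R); apply: le_trans Kw _.
  by rewrite ler_piMl //; lra.
suff : `|rho phi pi tau - rho (w%:R : R) pi sigma| <= k.+1%:R * (2 * d).
  move=> h; rewrite -(subrKA (rho (w%:R : R) pi sigma)) addrC.
  by apply: le_lt_trans (ler_normD _ _) _; rewrite ltr_leD // src.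
have phi1 : 1 <= phi.
  by apply: le_trans l1; rewrite ler1n muln_gt0 b0 ltnW.
have [k0|k0] := posnP k.
  rewrite {}k0 in pi kK kw *; rewrite !rho0 phi1 ler1n (ltnW w1) subrr normr0.
  by rewrite !mulr_ge0 // ltW.
rewrite rho_truncn.
have phi0 : 0 <= phi by apply: le_trans phi1.
have tphi : (Num.truncn phi)%:R <= phi by rewrite truncn_le.
move/dvdnP: bs => [q QE].
have q0 : (0 < q)%N by move: Q0; rewrite QE; case: (q).
apply: (scale_density d01 (Q := Q) (q := q) (b := b)) => //; rewrite -?QE //.
- by rewrite truncn_ge_nat.
- by apply: le_trans hQ; rewrite ler_wpM2r //; lra.
- rewrite natrB ?(ltnW ws) //; have s0 : (0 : R) <= s%:R by []; nra.
- rewrite natrM natrB //.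
  have kd : k%:R <= d * w%:R by apply: le_trans Kw; rewrite ler_nat.
  have bb : (0 : R) <= b%:R by [].
  move: l2; rewrite natrM => l2.
  apply: (@le_trans _ _ ((1 - 2 * d) * phi)).
    by rewrite ler_wpM2l //; lra.
  apply: (@le_trans _ _ ((1 - d) * ((1 - d) * phi))); first by nra.
  apply: (@le_trans _ _ ((1 - d) * (b%:R * w%:R))); first by rewrite ler_wpM2l //; lra.
  by nra.
Qed.

Lemma local_layer_rho Q n L (tau : 'S_n) k (pi : 'S_k) :
    (0 < Q <= n)%N -> (1 - d) * n%:R <= Q%:R -> (k <= K)%N ->
    local_layer Q L tau ->
  `|rho (k%:R : R) pi tau - L (existT _ k pi)| < eps + 2 * d.
Proof.
have [d0' d1' d_lt1'] := And3 d0 d1 d_lt1.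
move=> /andP[Q0 Qn] hQ kK [s [sigma [[Ks Kd src] [sQ bw]]]].
have d01 : 0 <= d <= 1 by rewrite ltW //=; lra.
suff : `|rho (k%:R : R) pi tau - rho (k%:R : R) pi sigma| <= 2 * d.
  move=> h; rewrite -(subrKA (rho (k%:R : R) pi sigma)) addrC.
  by apply: le_lt_trans (ler_normD _ _) _; rewrite ltr_leD // src.
have [k0|k0] := posnP k.
  by rewrite {}k0 in pi kK *; rewrite !rho0 subrr normr0 mulr_ge0 // ltW.
move/dvdnP: sQ => [q QE].
have q0 : (0 < q)%N by move: Q0; rewrite QE; case: (q).
apply: (local_density d01 (Q := Q) (q := q)) => //; rewrite -?QE //.
  exact: leq_ltn_trans Ks.
rewrite natrB; last by rewrite ltnW // (leq_ltn_trans kK).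
have : k%:R <= d * s%:R by apply: le_trans Kd; rewrite ler_nat.
by lra.
Qed.

(** [sigma] is inflated by runs of length [w'] and [sigma'] by runs of length [w], the results are
    crossed, and each point receives [r] copies of [tau]. Blocks have length [M * r * w'] for
    positions and [M * r * w] for values, so windows of [w], respectively [w'], blocks have the
    common width [M * r * w * w']. *)
Lemma add_scale_layer M (tau : 'S_M) phi Xi Xi' s (sigma : 'S_s) w s' (sigma' : 'S_s') w' :
    (0 < M)%N -> scale_source Xi sigma w -> scale_source Xi' sigma' w' ->
    (M * (w * w'))%:R <= d * phi ->
  exists N (tau' : 'S_N),
    [/\ (0 < N)%N, N%:R <= (s * s')%:R * phi, (M %| N)%N,
        blockwise N 1 tau tau' /\ blockwise N 1 tau^-1%g tau'^-1%g &
        scale_layer N phi Xi tau' /\ scale_layer N phi Xi' tau'^-1%g].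
Proof.
move=> M0 src src' hphi.
have [/andP[w1 ws] _ _ _] := src; have [/andP[w1' ws'] _ _ _] := src'.
have w0 := ltnW w1; have w0' := ltnW w1'.
have s0 := ltn_trans w0 ws; have s0' := ltn_trans w0' ws'.
have D0 : (0 < M * (w * w'))%N by rewrite !muln_gt0 M0 w0.
have D0' : (0 : R) < (M * (w * w'))%:R by rewrite ltr0n.
have phi0 : 0 < phi by rewrite -(pmulr_rgt0 _ d0) (lt_le_trans D0').
(* The largest [r] for which that width fits in [phi]; rounding loses less than [M * w * w'], at
   most [d * phi]. *)
pose r := Num.truncn (phi / (M * (w * w'))%:R).
have r0 : (0 < r)%N.
  rewrite /r truncn_gt0 ler_pdivlMr // mul1r (le_trans hphi) //.
  by rewrite ler_piMl ?ltW.
have /andP[r1 r2] : (M * r * (w * w'))%:R <= phi < (M * r * (w * w'))%:R + (M * (w * w'))%:R.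
  have /andP[] := truncn_itv (divr_ge0 (ltW phi0) (ltW D0')).
  rewrite -/r ler_pdivlMr // ltr_pdivrMr // -natr1 mulrDl mul1r -natrM.
  by rewrite mulnA [(r * M)%N]mulnC => -> ->.
(* Copies of the one-point permutation form the increasing runs. *)
have [A [bA _ _ _]] := @inflateP s 1 w' (s * (1 * w')) sigma 1%g isT w0' (leqnn _).
have [A' [bA' _ _ _]] := @inflateP s' 1 w (s' * (1 * w)) sigma' 1%g isT w0 (leqnn _).
have [q [qA qA']] := crossP A A'.
set a := (s * (1 * w'))%N in A bA q qA qA'; set a' := (s' * (1 * w))%N in A' bA' q qA qA'.
have a0 : (0 < a)%N by rewrite !muln_gt0 s0.
have a0' : (0 < a')%N by rewrite !muln_gt0 s0'.
have aa0 : (0 < a * a')%N by rewrite muln_gt0 a0.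
have [tau' [t1 t2 t3 t4]] := @inflateP (a * a') M r _ q tau M0 r0 (leqnn _).
have NE : (a * a' * (M * r) = s * s' * (M * r * (w * w')))%N.
  by rewrite /a /a'; nia.
have H1 : blockwise (a * a' * (M * r)) (M * r * 1 * (1 * w')) sigma tau'.
  apply: (blockwise_trans (rho := A)) => //; rewrite ?mul1n //.
    by rewrite /a mul1n mulnC.
  by apply: (blockwise_trans (rho := q)) => //; rewrite mul1n dvdn_mulr.
have H2 : blockwise (a * a' * (M * r)) (M * r * 1 * (1 * w)) sigma' tau'^-1%g.
  apply: (blockwise_trans (rho := A')) => //; rewrite ?mul1n //.
    by rewrite /a' mul1n mulnC.
  by apply: (blockwise_trans (rho := q^-1%g)) => //; rewrite mul1n dvdn_mull.
have Mr0 : (0 < M * r)%N by rewrite muln_gt0 M0.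
have lphi : (1 - d) * phi <= (M * r * (w * w'))%:R by move: r2 hphi; lra.
exists (a * a' * (M * r))%N, tau'; split.
- by rewrite muln_gt0 aa0.
- by rewrite NE natrM ler_wpM2l.
- by rewrite mulnCA dvdn_mulr.
- by split.
- split; [exists s, sigma, w, (M * r * 1 * (1 * w'))%N|
           exists s', sigma', w', (M * r * 1 * (1 * w))%N]; split=> //; split.
  + by rewrite muln1 mul1n muln_gt0 Mr0.
  + rewrite NE muln1 mul1n; apply/dvdnP; exists (s' * w)%N; nia.
  + by rewrite muln1 mul1n -mulnA [(w' * w)%N]mulnC.
  + by rewrite muln1 mul1n -mulnA [(w' * w)%N]mulnC.
  + exact: H1.
  + by rewrite muln1 mul1n muln_gt0 Mr0.
  + rewrite NE muln1 mul1n; apply/dvdnP; exists (s * w')%N; nia.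
  + by rewrite muln1 mul1n -mulnA.
  + by rewrite muln1 mul1n -mulnA.
  + exact: H2.
Qed.

Lemma base_layer L L' s (sigma : 'S_s) s' (sigma' : 'S_s') :
    local_source L sigma -> local_source L' sigma' ->
  exists tau : 'S_(s * s'),
    local_layer (s * s') L tau /\ local_layer (s * s') L' tau^-1%g.
Proof.
move=> src src'; have [q [qA qA']] := crossP sigma sigma'.
exists q; split; [exists s, sigma|exists s', sigma']; split=> //; split=> //.
  exact: dvdn_mulr.
exact: dvdn_mull.
Qed.

(** * Stacking the layers in the order of domination *)

Variables (f : nat -> nat -> R) (Xi Xi' : nat -> AnyPerm -> R) (L L' : AnyPerm -> R).
Hypothesis fscale : forall t, scaling_function (f t).
Hypotheses (XiP : forall t, scale_limit (Xi t)) (XiP' : forall t, scale_limit (Xi' t)).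
Hypotheses (LP : local_limit L) (LP' : local_limit L').

Definition layered (done : nat -> Prop) (n Q m : nat) (tau : 'S_m) : Prop :=
  [/\ local_layer Q L tau, local_layer Q L' tau^-1%g &
      forall t, done t -> scale_layer Q (f t n) (Xi t) tau /\
                          scale_layer Q (f t n) (Xi' t) tau^-1%g].

Lemma layered_trans done n Q m r (rho : 'S_r) (tau : 'S_m) :
    (0 < r)%N -> (r %| Q)%N -> blockwise Q 1 rho tau ->
    blockwise Q 1 rho^-1%g tau^-1%g ->
  layered done n r rho -> layered done n Q tau.
Proof.
move=> r0 rQ b1 b2 [l1 l2 l3]; split.
- exact: local_layer_trans l1.
- exact: local_layer_trans l2.
- move=> t /l3[h1 h2]; split.
    exact: scale_layer_trans h1.
  exact: scale_layer_trans h2.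
Qed.

(** [h] controls the size of the permutation built so far, so a scale dominating [h] sees it as
    negligible. [C] is fixed before [n] and absorbs the sizes of the sources. *)
Definition layers_below (done : nat -> Prop) (h : nat -> R) : Prop :=
  exists C : R, \forall n \near \oo, exists N (tau : 'S_N),
    [/\ (0 < N)%N, N%:R <= C * h n & layered done n N tau].

Lemma layers_below0 : layers_below (fun=> False) (fun=> 1).
Proof.
have [s [sigma src]] := local_sourceP LP; have [s' [sigma' src']] := local_sourceP LP'.
have [tau [l1 l2]] := base_layer src src'.
exists (s * s')%:R; near=> n; exists (s * s')%N, tau; split=> //; last by rewrite mulr1.
rewrite muln_gt0; case: src => Ks _ _; case: src' => Ks' _ _.
by rewrite (leq_ltn_trans _ Ks) // (leq_ltn_trans _ Ks').
Unshelve. all: by end_near.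
Qed.

Lemma dom_ll_near (h g : nat -> R) (C e : R) : dom_ll h g -> 0 < e ->
  (\forall n \near \oo, 0 < g n) ->
  \forall n \near \oo, C * h n <= e * g n.
Proof.
move=> hg e0 gpos.
have e1 : 0 < e / (`|C| + 1) by rewrite divr_gt0 // ltr_wpDl.
have /cvgrPdist_lt/(_ _ e1) := hg.
move=> hn; near=> n.
have g0 : 0 < g n by near: n.
have : `|h n / g n| < e / (`|C| + 1) by rewrite -normrN -sub0r; near: n.
rewrite normrM normfV (gtr0_norm g0) ltr_pdivrMr // => h1.
apply: le_trans (ler_norm _) _; rewrite normrM.
apply: (@le_trans _ _ ((`|C| + 1) * `|h n|)); first by rewrite ler_wpM2r // lerDl.
apply: (@le_trans _ _ ((`|C| + 1) * (e / (`|C| + 1) * g n))).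
  by rewrite ler_wpM2l ?ltW // ltr_wpDl.
by rewrite mulrA mulrCA divff ?mulr1 // gt_eqF // ltr_wpDl.
Unshelve. all: by end_near.
Qed.

Lemma scaling_pos t : \forall n \near \oo, 0 < f t n.
Proof.
near=> n; have [fp _] := fscale t; have [] // := fp n.
by near: n; exact: nbhs_infty_gt.
Unshelve. all: by end_near.
Qed.

Lemma layers_belowS done h t : layers_below done h -> dom_ll h (f t) ->
  layers_below (fun u => u = t \/ done u) (f t).
Proof.
move=> [C hC] hf.
have [s [sigma [w src]]] := scale_sourceP (XiP t).
have [s' [sigma' [w' src']]] := scale_sourceP (XiP' t).
have hd := dom_ll_near (C * (w * w')%:R) hf d0 (scaling_pos t).
exists (s * s')%:R; near=> n.
have [M [tau [M0 MC lay]]] : exists N (tau : 'S_N),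
    [/\ (0 < N)%N, N%:R <= C * h n & layered done n N tau] by near: n.
have hphi : (M * (w * w'))%:R <= d * f t n.
  apply: (@le_trans _ _ (C * (w * w')%:R * h n)); last by near: n.
  by rewrite natrM mulrAC ler_wpM2r.
have [N [tau' [N0 NC MN [b1 b2] [l1 l2]]]] := add_scale_layer tau M0 src src' hphi.
exists N, tau'; split=> //.
have [m1 m2 m3] := layered_trans M0 MN b1 b2 lay.
by split=> // u [->|/m3].
Unshelve. all: by end_near.
Qed.

Lemma layers_below_path done t l : layers_below done (f t) ->
    path (fun a b => `[< dom_ll (f a) (f b) >]) t l ->
  layers_below (fun u => u \in l \/ done u) (f (last t l)).
Proof.
elim: l done t => [|u l IH] done t lay /=.
  move=> _; case: lay => C hC; exists C; apply: filterS hC => n [N [tau [N0 NC [l1 l2 l3]]]].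
  by exists N, tau; split=> //; split=> // v [//|/l3].
move=> /andP[/asboolP tu pl]; have := IH _ _ (layers_belowS lay tu) pl.
case=> C hC; exists C; apply: filterS hC => n [N [tau [N0 NC [l1 l2 l3]]]].
exists N, tau; split=> //; split=> // v [|dv]; last by apply: l3; right; right.
by rewrite inE => /orP[/eqP ->|vl]; apply: l3; [right; left|left].
Qed.

Hypothesis fdom : forall t s, t <> s -> dom_ll (f t) (f s) \/ dom_ll (f s) (f t).
Variable G : probability (measurableTypeR R * measurableTypeR R)%type R.
Hypothesis permG : permuton G.

(** Sorting uses a total, hence reflexive, relation; absence of repetitions recovers strict
    domination between neighbours. *)
Lemma path_strict (T : eqType) (lt : rel T) (x : T) l :
    uniq (x :: l) -> path (fun a b => (a == b) || lt a b) x l -> path lt x l.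
Proof.
elim: l x => // y l IH x; rewrite [uniq _]/= inE negb_or -andbA.
move=> /and3P[xy _ ul] /= /andP[h p]; rewrite IH // andbT.
by move: h; rewrite (negbTE xy).
Qed.

Lemma layers_below_upto J : exists t, layers_below (fun u => (u <= J)%N) (f t).
Proof.
pose lt a b := `[< dom_ll (f a) (f b) >].
pose le a b := (a == b) || lt a b.
have le_tot : total le.
  move=> a b; rewrite /le /lt eq_sym; have [//|/eqP ab] := eqVneq b a.
  by apply/orP; case: (fdom ab) => h; [right|left]; apply/asboolP.
have su : uniq (sort le (iota 0 J.+1)) by rewrite sort_uniq iota_uniq.
have ss := sort_sorted le_tot (iota 0 J.+1).
have sm u : (u \in sort le (iota 0 J.+1)) = (u <= J)%N.
  by rewrite mem_sort mem_iota.
case: (sort le _) su ss sm => [|t l] su ss sm; first by have := sm 0.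
(* The local layer has bounded size, so it lies below even the smallest scale. *)
have one_f : dom_ll (fun=> 1) (f t).
  apply/cvgrPdist_lt => e e0; have [_ [fi _]] := fscale t.
  have [N NP] := fi e^-1; exists N => // n /NP fe.
  have f0 : 0 < f t n by apply: lt_trans fe; rewrite invr_gt0.
  by rewrite sub0r normrN mul1r gtr0_norm ?invr_gt0 // invf_plt.
have := layers_below_path (layers_belowS layers_below0 one_f) (path_strict su ss).
case=> C hC; exists (last t l), C; apply: filterS hC => n [N [tau [N0 NC [l1 l2 l3]]]].
exists N, tau; split=> //; split=> // u uJ; apply: l3.
by move: uJ; rewrite -sm inE => /orP[/eqP ->|]; [right; left|left].
Qed.

(** The outermost inflation puts consecutive copies of the layered permutation, of size [M], into
    the points of [gam], which approximates the permuton. *)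
Lemma stage J n0 : exists n (tau : 'S_n), (n0 <= n)%N /\
  forall k (pi : 'S_k), (k <= K)%N ->
    [/\ forall t, (t <= J)%N ->
          `|rho (f t n) pi tau - Xi t (existT _ k pi)| < eps + K.+1%:R * (2 * d) /\
          `|rho (f t n) pi tau^-1%g - Xi' t (existT _ k pi)| < eps + K.+1%:R * (2 * d),
        `|rho (k%:R : R) pi tau - L (existT _ k pi)| < eps + K.+1%:R * (2 * d),
        `|rho (k%:R : R) pi tau^-1%g - L' (existT _ k pi)| < eps + K.+1%:R * (2 * d) &
        `|rho (n%:R : R) pi tau - rho_permuton G (existT _ k pi)| < eps + K.+1%:R * (2 * d)].
Proof.
have [d0' d1' d_lt1'] := And3 d0 d1 d_lt1.
have [t [C hC]] := layers_below_upto J.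
have [g [gam [gbig gamP]]] :=
  permuton_approx K (maxn K (Num.truncn (K%:R / d))).+1 permG eps0.
have [_ [_ flin]] := fscale t.
(* Even the largest scale is sublinear: [g] copies of the layered permutation fill at most a
   fraction [d] of [n], which also bounds the remainder left outside the frames. *)
have hd : \forall n \near \oo, C * g%:R * f t n <= d * n%:R.
  apply: dom_ll_near => //; near=> n; rewrite ltr0n.
  by near: n; exact: nbhs_infty_gt.
have nbig : \forall n \near \oo, (maxn n0 K.+1 <= n)%N by exact: nbhs_infty_ge.
have [n [[hn nd] nn]] := filter_ex (filterI (filterI hC hd) nbig).
move: hn => [M [rho0' [M0 MC lay]]].
move: nn; rewrite geq_max => /andP[nn0 nK].
have Kg : (K < g)%N by apply: leq_trans gbig; rewrite ltnS leq_maxl.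
have Kd : K%:R <= d * g%:R.
  rewrite mulrC -ler_pdivrMr //; apply/ltW; apply: lt_le_trans (truncnS_gt _) _.
  by rewrite ler_nat (leq_trans _ gbig) // ltnS leq_maxr.
have g0 : (0 < g)%N by apply: leq_ltn_trans Kg.
have nR : (0 : R) < n%:R by rewrite ltr0n (leq_trans _ nK).
have Mgd : (g * M)%:R <= d * n%:R.
  apply: le_trans nd; rewrite natrM mulrC mulrAC ler_wpM2r //.
have gM0 : (0 < g * M)%N by rewrite muln_gt0 g0.
have Mgn : (g * M <= n)%N.
  by rewrite -(ler_nat R) (le_trans Mgd) // ler_piMl // ltW.
pose r := (n %/ (g * M))%N.
have r0 : (0 < r)%N by rewrite divn_gt0.
have QE : (g * (M * r) = r * (g * M))%N by rewrite mulnA mulnC.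
have Qn : (g * (M * r) <= n)%N by rewrite QE leq_trunc_div.
have [tau [t1 t2 t3 t4]] := @inflateP g M r n gam rho0' M0 r0 Qn.
set Q := (g * (M * r))%N in QE Qn t1 t2 t3 t4.
have Q0 : (0 < Q <= n)%N by rewrite Qn QE muln_gt0 r0 gM0.
have hQ : (1 - d) * n%:R <= Q%:R.
  have : (n < Q + g * M)%N by rewrite QE addnC -mulSn ltn_ceil.
  by rewrite -(ltr_nat R) natrD; move: Mgd; lra.
have MQ : (M %| Q)%N by rewrite /Q mulnCA dvdn_mulr.
have [l1 l2 l3] := layered_trans M0 MQ t2 t4 lay.
have Kd0 : 0 <= K%:R * d by rewrite mulr_ge0 // ltW.
have dK : 2 * d <= K.+1%:R * (2 * d) by rewrite -natr1; lra.
exists n, tau; split=> // k pi kK.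
have kd : k.+1%:R * (2 * d) <= K.+1%:R * (2 * d).
  by rewrite ler_wpM2r ?ler_nat //; lra.
split.
- move=> u uJ; have [h1 h2] := l3 u uJ; split.
    by apply: lt_le_trans (scale_layer_rho pi Q0 hQ kK h1) _; rewrite lerD2l.
  by apply: lt_le_trans (scale_layer_rho pi Q0 hQ kK h2) _; rewrite lerD2l.
- by apply: lt_le_trans (local_layer_rho pi Q0 hQ kK l1) _; rewrite lerD2l.
- by apply: lt_le_trans (local_layer_rho pi Q0 hQ kK l2) _; rewrite lerD2l.
suff h : `|rho (n%:R : R) pi tau - rho (g%:R : R) pi gam| <= K.+1%:R * (2 * d).
  rewrite -(subrKA (rho (g%:R : R) pi gam)) addrC.
  by apply: le_lt_trans (ler_normD _ _) _; rewrite ltr_leD // gamP.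
apply: le_trans kd.
have [k0|k0] := posnP k.
  rewrite {}k0 in pi kK *; rewrite !rho0 !ler1n g0 -(ltr0n R) nR subrr normr0.
  by rewrite !mulr_ge0 // ltW.
apply: (@le_trans _ _ (k%:R * (2 * d))); last first.
  by rewrite ler_wpM2r ?ler_nat //; lra.
have kn : (k <= n)%N by rewrite (leq_trans kK) // ltnW.
have d01 : 0 <= 2 * d <= 1 by apply/andP; split; lra.
apply: (global_density d01 (Q := Q) (b := (M * r)%N)) => //.
  by rewrite mulnC.
have kg : (k <= g)%N by rewrite (leq_trans kK) // ltnW.
move: (M * r)%N @Q QE Qn t1 t2 t3 t4 Q0 hQ MQ l1 l2 l3 => B Q _ _ _ _ _ _ _ hQ _ _ _ _.
have BQ : Q%:R = B%:R * g%:R :> R by rewrite -natrM mulnC.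
have kd' : k%:R <= d * g%:R :> R by rewrite (le_trans _ Kd) // ler_nat.
have B0 : (0 : R) <= B%:R by [].
rewrite natrM natrB //.
apply: (@le_trans _ _ ((1 - d) * ((1 - d) * n%:R))); first by nra.
apply: (@le_trans _ _ ((1 - d) * Q%:R)); first by rewrite ler_wpM2l //; lra.
by rewrite BQ; nra.
Unshelve. all: by end_near.
Qed.
End Layers.

(** * Diagonal argument *)

Lemma cvg_of_stages (R : realType) (u : nat -> R) (l : R) J0 :
  (forall J, (J0 <= J)%N -> `|u J - l| < J.+1%:R^-1 + J.+1%:R^-1) -> u @ \oo --> l.
Proof.
move=> h; apply/cvgrPdist_lt => e e0; near=> J.
rewrite distrC; apply: lt_le_trans (h J _) _; first by near: J; exact: nbhs_infty_ge.
have : `|0 - harmonic J| < e / 2 :> R.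
  near: J; have /cvgrPdist_lt := @cvg_harmonic R; apply; exact: divr_gt0.
rewrite sub0r normrN /harmonic /= gtr0_norm ?invr_gt0 //.
by move=> hJ; rewrite [leRHS]splitr lerD // ltW.
Unshelve. all: by end_near.
Qed.

Theorem mainTheorem12 (R : realType) (f : nat -> nat -> R)
  (Xi Xi' : nat -> AnyPerm -> R)
  (G : probability (measurableTypeR R * measurableTypeR R)%type R)
  (L L' : AnyPerm -> R) :
  (forall t, scaling_function (f t)) ->
  (forall t s, t <> s -> dom_ll (f t) (f s) \/ dom_ll (f s) (f t)) ->
  (forall t, scale_limit (Xi t)) ->
  (forall t, scale_limit (Xi' t)) ->
  permuton G ->
  local_limit L -> local_limit L' ->
  exists tau : nat -> AnyPerm,
    size_to_infty tau /\
    (forall t, conv_at_scale (f t) tau (Xi t)) /\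
    conv_globally tau G /\
    conv_locally tau L /\
    (forall t, conv_at_scale (f t) (fun j => anyperm_inv (tau j)) (Xi' t)) /\
    conv_locally (fun j => anyperm_inv (tau j)) L'.
Proof.
move=> fsc fdom XiP XiP' permG LP LP'.
have cho J : exists T : AnyPerm, (J <= psize T)%N /\
    forall pi : AnyPerm, (psize pi <= J)%N ->
    [/\ forall t, (t <= J)%N ->
          `|rhoP (f t (psize T)) pi T - Xi t pi| < J.+1%:R^-1 + J.+1%:R^-1 /\
          `|rhoP (f t (psize T)) pi (anyperm_inv T) - Xi' t pi| < J.+1%:R^-1 + J.+1%:R^-1,
        `|rhoP ((psize pi)%:R : R) pi T - L pi| < J.+1%:R^-1 + J.+1%:R^-1,
        `|rhoP ((psize pi)%:R : R) pi (anyperm_inv T) - L' pi| < J.+1%:R^-1 + J.+1%:R^-1 &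
        `|rhoP ((psize T)%:R : R) pi T - rho_permuton G pi| < J.+1%:R^-1 + J.+1%:R^-1].
  pose e : R := J.+1%:R^-1.
  have e0 : 0 < e by rewrite invr_gt0.
  (* This loss makes the error term [J.+1 * (2 * d)] of [stage] equal to [e]. *)
  have d0 : 0 < e / (2 * J.+1%:R) by rewrite divr_gt0 // mulr_gt0.
  have dE : J.+1%:R * (2 * (e / (2 * J.+1%:R))) = e.
    by rewrite mulrA [J.+1%:R * 2]mulrC mulrCA divff ?mulr1 ?mulf_neq0 ?pnatr_eq0.
  have d1 : 2 * (e / (2 * J.+1%:R)) <= 1.
    apply: (@le_trans _ _ e); last by rewrite invf_le1 // ler1n.
    by rewrite -{2}dE ler_peMl ?ler1n // mulr_ge0 // ltW.
  have [n [tau [Jn h]]] := stage J e0 d0 d1 fsc XiP XiP' LP LP' fdom permG J J.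
  exists (existT _ n tau); split=> // -[k pi] kJ.
  by have := h k pi kJ; rewrite dE.
have [T TP] := choice cho.
exists T; split; first by move=> M; exists M => j Mj; apply: leq_trans Mj (TP j).1.
(* From this stage on, both the scale [t] and the pattern [pi] are covered. *)
split; first by move=> t pi; apply: (@cvg_of_stages _ _ _ (maxn t (psize pi))) => J;
  rewrite geq_max => /andP[tJ pJ]; case: ((TP J).2 pi pJ) => /(_ t tJ)[].
split; first by move=> pi; apply: (@cvg_of_stages _ _ _ (psize pi)) => J pJ;
  case: ((TP J).2 pi pJ).
split; first by move=> pi; apply: (@cvg_of_stages _ _ _ (psize pi)) => J pJ;
  case: ((TP J).2 pi pJ).
split; first by move=> t pi; apply: (@cvg_of_stages _ _ _ (maxn t (psize pi))) => J;
  rewrite geq_max => /andP[tJ pJ]; case: ((TP J).2 pi pJ) => /(_ t tJ)[].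
by move=> pi; apply: (@cvg_of_stages _ _ _ (psize pi)) => J pJ; case: ((TP J).2 pi pJ).
Qed.
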